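(* Let $N\ge 2$, let $r>0$ and $1<p<\infty$ be fixed. For $R>r$ let $S_p(B_r)$ be the constant associated with $\Omega=B_R\subset\mathbb{R}^N$ and the hole $B_r$, and let $$ Q(R)=\frac{1}{S_p(B_r)^{\frac{p}{p-1}}}\left(1-\frac{N-1}{R}S_p(B_r)\right)+1 . $$ Then $$ \lim_{R\to r}Q(R)=1^-\quad\text{and}\quad \lim_{R\to+\infty}Q(R)=p, $$ where the first assertion means that $Q(R)\to1$ as $R\to r^+$ and $Q(R)<1$ for all $R>r$ sufficiently close to $r$.
   Context: $B_\rho$ is the open ball of $\mathbb{R}^N$ with center $0$ and radius $\rho$. With $\Omega=B_R$ and $A=B_r$, $W^{1,p}_A(\Omega)$ denotes the closure in the $W^{1,p}(\Omega)$-norm of $C_0^\infty(\overline{\Omega}\setminus A)$ (functions smooth up to $\partial\Omega$ that vanish on $A$, with no condition imposed on $\partial\Omega$), and $$ S_p(B_r)=\inf_{u\in W^{1,p}_{A}(\Omega)\setminus W^{1,p}_0(\Omega)}\frac{\int_\Omega |\nabla u|^p+|u|^p\,\mathrm{d}x}{\int_{\partial\Omega}|u|^p\,\mathrm{d}S}, $$ which depends on $R$. *)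

(* Defs.v *)
From HB Require Import structures.
From mathcomp Require Import all_boot all_order all_algebra.
From mathcomp Require Import all_classical all_reals all_analysis.
From mathcomp Require Import measurable_realfun.

Set Implicit Arguments.
Unset Strict Implicit.
Unset Printing Implicit Defensive.

Import Order.TTheory GRing.Theory Num.Theory.
Import numFieldNormedType.Exports.

Local Open Scope classical_set_scope.
Local Open Scope ring_scope.

(* The measurable structure on R^n is the product of the Borel sigma-algebras
   of the coordinates, as for n.-tuple R in MathComp-Analysis. *)
Definition measure_rV_display : measure_display.
Proof. exact: default_measure_display. Qed.

Section measurable_rV.
Context (R : realType) (n : nat).

Definition rV_coor (i : 'I_n) (x : 'rV[R]_n) : R := x ord0 i.

Let rV_set0 : g_sigma_preimage rV_coor set0.
Proof. exact: sigma_algebra0. Qed.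

Let rV_setC A : g_sigma_preimage rV_coor A -> g_sigma_preimage rV_coor (~` A).
Proof. exact: sigma_algebraC. Qed.

Let rV_bigcup (F : (set 'rV[R]_n)^nat) :
  (forall i, g_sigma_preimage rV_coor (F i)) ->
  g_sigma_preimage rV_coor (\bigcup_i (F i)).
Proof. exact: sigma_algebra_bigcup. Qed.

HB.instance Definition _ := @isMeasurable.Build measure_rV_display
  'rV[R]_n (g_sigma_preimage rV_coor) rV_set0 rV_setC rV_bigcup.

End measurable_rV.

Lemma measurable_rV_coor (R : realType) n (i : 'I_n) :
  measurable_fun [set: 'rV[R]_n] (fun x : 'rV[R]_n => x ord0 i).
Proof.
move=> _ Y mY; rewrite setTI; apply: sub_sigma_algebra => /=.
rewrite -bigcup_seq/=; exists i => /=; first by rewrite mem_index_enum.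
by exists Y => //; rewrite setTI.
Qed.

Lemma measurable_fun_rVP d (T : measurableType d) (R : realType) n
    (f : T -> 'rV[R]_n) :
  (forall i, measurable_fun [set: T] (fun t => f t ord0 i)) ->
  measurable_fun [set: T] f.
Proof.
move=> mf; have : g_sigma_preimage (fun i => @rV_coor R n i \o f) `<=` measurable.
  apply: smallest_sub; first exact: sigma_algebra_measurable.
  case: n => [|n] in f mf *; first by rewrite big_ord0.
  rewrite -bigcup_mkord_ord; apply: bigcup_sub => i Ii.
  by move=> A [B mB <-]; exact: mf.
rewrite g_sigma_preimage_comp => fS _ A mA.
by apply: fS; exists A.
Qed.

(* pushforward along a bundled measurable function, so that it is inferred to
   be a measure (compare distribution, which is restricted to probabilities). *)
Definition image_measure d d' (T : measurableType d) (T' : measurableType d')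
    (R : realType) (m : {measure set T -> \bar R}) (f : {mfun T >-> T'}) :=
  pushforward m f.

Section image_measure_is_measure.
Context d d' (T : measurableType d) (T' : measurableType d') (R : realType).
Variables (m : {measure set T -> \bar R}) (f : {mfun T >-> T'}).

Let image_measure0 : image_measure m f set0 = 0%E.
Proof. exact: measure0. Qed.

Let image_measure_ge0 A : (0 <= image_measure m f A)%E.
Proof. exact: measure_ge0. Qed.

Let image_measure_sigma_additive : semi_sigma_additive (image_measure m f).
Proof. exact: measure_semi_sigma_additive. Qed.

HB.instance Definition _ := isMeasure.Build _ _ _ (image_measure m f)
  image_measure0 image_measure_ge0 image_measure_sigma_additive.

End image_measure_is_measure.

Section lebesgue_rV.
Context (R : realType).
Local Open Scope ereal_scope.

Definition rV_cons n (z : 'rV[R]_n * measurableTypeR R) : 'rV[R]_n.+1 :=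
  row_mx (const_mx (z.2 : R) : 'rV[R]_1) z.1.

Lemma measurable_rV_cons n : measurable_fun [set: 'rV[R]_n * measurableTypeR R] (@rV_cons n).
Proof.
apply: measurable_fun_rVP => i.
rewrite /rV_cons; case: (@split_ordP 1 n i) => j ->.
  by under eq_fun do rewrite (@row_mxEl _ 1 1 n) mxE; exact: measurable_snd.
under eq_fun do rewrite (@row_mxEr _ 1 1 n).
exact: (measurableT_comp (@measurable_rV_coor R n j) measurable_fst).
Qed.

HB.instance Definition _ n := isMeasurableFun.Build _ _ _ _ (@rV_cons n)
  (@measurable_rV_cons n).

(* Lebesgue measure on R^n: the n-fold product of the one-dimensional one. *)
Fixpoint lebesgue_rV n : {measure set 'rV[R]_n -> \bar R} :=
  if n is m.+1 then
    image_measure (lebesgue_rV m \x (@lebesgue_measure R)) (@rV_cons m)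
  else \d_ (0%R : 'rV[R]_0).

End lebesgue_rV.

Section euclidean.
Context (R : realType) (N : nat).
Implicit Types (x : 'rV[R]_N) (rho : R).

(* The MathComp-Analysis norm on 'rV[R]_N is the sup norm, hence this one. *)
Definition enorm x : R := Num.sqrt (\sum_(i < N) x ord0 i ^+ 2).

Definition eball rho : set 'rV[R]_N := [set x | enorm x < rho].

Definition esphere rho : set 'rV[R]_N := [set x | enorm x = rho].

Lemma measurable_enorm : measurable_fun [set: 'rV[R]_N] enorm.
Proof.
rewrite /enorm.
apply: (@measurableT_comp _ _ _ _ _ _ (@Num.sqrt R)).
  exact: continuous_measurable_fun (@sqrt_continuous R).
apply: measurable_sum => i; apply: measurable_funX; exact: measurable_rV_coor.
Qed.

Lemma measurable_eball rho : measurable (eball rho).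
Proof.
rewrite -[eball _]setTI (_ : eball rho = enorm @^-1` `]-oo, rho[%classic).
  by apply: measurable_enorm.
by apply/seteqP; split => x /=; rewrite in_itv.
Qed.

Definition sphere_proj rho x : 'rV[R]_N := (rho / enorm x) *: x.

Lemma measurable_inv : measurable_fun [set: R] (@GRing.inv R).
Proof.
rewrite -(setvU [set (0 : R)]); apply/measurable_funU => //; first exact: measurableC.
split; last exact: measurable_fun_set1.
apply: open_continuous_measurable_fun; first exact/closed_openC/closed_eq.
by move=> x; rewrite inE/= => /eqP x0; exact: inv_continuous.
Qed.

Lemma measurable_sphere_proj rho :
  measurable_fun [set: 'rV[R]_N] (sphere_proj rho).
Proof.
apply: measurable_fun_rVP => i; under eq_fun do rewrite mxE.
apply: measurable_funM; last exact: measurable_rV_coor.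
apply: measurable_funM => //.
exact: (measurableT_comp measurable_inv measurable_enorm).
Qed.

HB.instance Definition _ rho := isMeasurableFun.Build _ _ _ _ (sphere_proj rho)
  (measurable_sphere_proj rho).

(* Surface measure on the sphere of radius rho > 0: the measure of a part E of
   the sphere is N / rho times the volume of the cone { t x | 0 < t < 1, x in E}
   (so that dx = dS(x) dt in polar coordinates). The absolute value only
   serves to provide a nonnegative scaling factor for every real rho. *)
Definition surface rho : {measure set 'rV[R]_N -> \bar R} :=
  mscale (`|N%:R / rho|)%:nng
    (image_measure (mrestr (lebesgue_rV R N) (measurable_eball rho))
       (sphere_proj rho)).

End euclidean.

Arguments eball {R} N rho _.
Arguments esphere {R} N rho _.
Arguments surface {R} N rho.

Section sobolev.
Context (R : realType) (N : nat).
Implicit Types (phi u v : 'rV[R]_N -> R) (g : 'rV[R]_N -> 'rV[R]_N).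
Implicit Types (p rho : R) (Omega A : set 'rV[R]_N).

Definition partial (i : 'I_N) phi : 'rV[R]_N -> R :=
  fun x => 'D_(delta_mx ord0 i) phi x.

Definition grad phi : 'rV[R]_N -> 'rV[R]_N := fun x => \row_i partial i phi x.

(* C^oo on R^N: the iterated partial derivatives of all orders exist and are
   continuous. *)
Definition smooth phi : Prop := forall s : seq 'I_N,
  let f := foldr partial phi s in
  continuous f /\ forall i x, derivable f x (delta_mx ord0 i).

Definition test_functions Omega : set ('rV[R]_N -> R) :=
  [set phi | smooth phi /\ exists K : set 'rV[R]_N,
     [/\ compact K, K `<=` Omega & forall x, ~ K x -> phi x = 0]].

(* Functions smooth up to the boundary are restrictions of smooth functions on
   R^N; only their values on the closure of the domain are ever used. *)
Definition smooth_vanishing_on A : set ('rV[R]_N -> R) :=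
  [set phi | smooth phi /\ forall x, A x -> phi x = 0].

Definition energy p Omega u g : \bar R :=
  (\int[lebesgue_rV R N]_(x in Omega) (enorm (g x) `^ p + `|u x| `^ p)%:E)%E.

Definition sobolev_norm p Omega u g : \bar R := (energy p Omega u g `^ p^-1)%E.

(* W^{1,p}(Omega): a (representative of a) function together with (a
   representative of) its weak gradient; finiteness of the energy says that
   both are p-integrable. *)
Record sobolev p Omega := Sobolev {
  sob_fun :> 'rV[R]_N -> R ;
  sob_grad : 'rV[R]_N -> 'rV[R]_N ;
  measurable_sob_fun : measurable_fun Omega sob_fun ;
  measurable_sob_grad : measurable_fun Omega sob_grad ;
  sob_energy_lty : (energy p Omega sob_fun sob_grad < +oo)%E ;
  sob_weak_grad : forall phi, test_functions Omega phi -> forall i : 'I_N,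
    \int[lebesgue_rV R N]_(x in Omega) (sob_fun x * partial i phi x) =
    - \int[lebesgue_rV R N]_(x in Omega) (sob_grad x ord0 i * phi x) }.

Definition sobolev_dist p Omega (w : sobolev p Omega) phi : \bar R :=
  sobolev_norm p Omega (fun x => w x - phi x)
    (fun x => sob_grad w x - grad phi x).

Definition sobolev_closure p Omega (S : set ('rV[R]_N -> R)) :
    set (sobolev p Omega) :=
  [set w | forall e : R, 0 < e ->
     exists2 phi, S phi & (sobolev_dist w phi < e%:E)%E].

(* W^{1,p}_A(Omega). For A open in a bounded Omega, vanishing on A is the same
   as having compact support in (closure Omega) \ A. *)
Definition W1p_hole p Omega A : set (sobolev p Omega) :=
  @sobolev_closure p Omega (smooth_vanishing_on A).

Definition W1p_0 p Omega : set (sobolev p Omega) :=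
  @sobolev_closure p Omega (test_functions Omega).

Definition boundary_energy p rho v : \bar R :=
  (\int[surface N rho]_(x in esphere N rho) (`|v x| `^ p)%:E)%E.

(* v is the trace of w on the sphere bounding the ball of radius rho: the
   trace operator is the continuous extension to W^{1,p} of the restriction of
   smooth functions, so its graph is the closure of the graph of the latter in
   W^{1,p}(ball) x L^p(sphere). *)
Definition is_trace p rho (w : sobolev p (eball N rho)) v : Prop :=
  measurable_fun (esphere N rho) v /\
  forall e : R, 0 < e -> exists phi,
    [/\ smooth phi, (sobolev_dist w phi < e%:E)%E &
        (boundary_energy p rho (fun x => (phi x - v x)%R) < e%:E)%E].

(* S_p(B_r) for Omega = B_rho. The quotient is taken in the extended reals,
   where x / 0 = +oo for x > 0. *)
Definition steklov p r rho : \bar R :=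
  ereal_inf [set q | exists (w : sobolev p (eball N rho)) v,
    [/\ W1p_hole (eball N r) w, ~ W1p_0 w, is_trace w v &
        q = energy p (eball N rho) w (sob_grad w) / boundary_energy p rho v]]%E.

Definition Qfun p r rho : R :=
  let S := fine (steklov p r rho) in
  (S `^ (p / (p - 1)))^-1 * (1 - (N%:R - 1) / rho * S) + 1.

End sobolev.

(* Main.v *)
(* By Tonelli's theorem and scaling, the integral over x of the integral over
   t > a of F(t x) dt/t is a^(-N)/N times the integral of F. As the surface
   measure is the cone measure, estimates of |phi(rho x/|x|)|^p along the ray
   through x therefore turn into trace inequalities on the ball.
   Integrating the derivative of |phi(t x)|^p and applying Young's inequality with
   the weight K = (p-1)^((p-1)/p) gives
     boundary energy <= (K + N/R) * energy,
   first for smooth functions, then on their closure; hence S_p >= 1/(K + N/R).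
   Conversely the functions exp(-1/(|x|^2 - r^2)) (|x|/R)^(2k+2), with 2k/R tending
   to (p-1)^(-1/p), give upper bounds tending to 1/K. So S_p tends to
   (p-1)^(-(p-1)/p) as R tends to infinity, and Q(R) to p.
   When R is close to r, phi vanishes at distance R - r from the sphere, and the
   same method yields boundary energy <= C (R-r)^(p-1) * energy. So S_p tends to
   infinity, which makes Q(R) tend to 1 and stay below 1, since
   1 - (N-1) S_p / R is eventually negative. *)
From HB Require Import structures.
From mathcomp Require Import all_boot all_order all_algebra.
From mathcomp Require Import all_classical all_reals all_analysis.
From mathcomp Require Import measurable_realfun.
From mathcomp Require Import ring lra.
Require Import Defs.

Set Implicit Arguments.
Unset Strict Implicit.
Unset Printing Implicit Defensive.

Import Order.TTheory GRing.Theory Num.Theory.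
Import numFieldNormedType.Exports.

Local Open Scope classical_set_scope.
Local Open Scope ring_scope.

(** * Lebesgue measure on R^n *)

(** The free weight in Young's inequality is chosen differently at the two ends. For large R the
    bound valid for arbitrary smooth functions is already asymptotically sharp: for competitors with
    2k/R near c the quotient tends to (c^p + 1)/(c p), whose minimum, at c^p = 1/(p-1), is exactly
    1/K. Since K^(p/(p-1)) = p - 1, the limit of Q is (p - 1) + 1. Near the hole the weight is
    (R-r)^(p-1), so the coefficient of |phi|^p is as large as (p-1)/(R-r). A factor t^-m with m of
    order R (p-1)/(R-r) absorbs that term along each ray; it costs (R/r)^m, which stays bounded
    because R/r = 1 + (R-r)/r. Then Q - 1 = S^-q - (N-1)/R S^(1-q) with q = p/(p-1) > 1. Passing to
    the closure is delicate: the approximations that vanish on the hole and those that define the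
    trace are unrelated, and only the inequality for arbitrary smooth functions, applied to their
    difference, links them. Finally, [fine] sends infinite values to 0, so S_p must be shown finite
    for every R > r, which takes an admissible competitor even near the hole. *)

Section lebesgue_rV_theory.
Context (R : realType).
Implicit Types (n : nat).

Local Notation mu := (@lebesgue_measure R).

(** Closed cubes have an explicit product measure; they give sigma-finiteness, comparison with
    balls, and the supports of dominating functions. *)
Definition rV_box n (a : R) : set 'rV[R]_n := [set x | forall i, `|x ord0 i| <= a].

Lemma measurable_rV_box n a : measurable (@rV_box n a).
Proof.
rewrite (_ : rV_box a =
    \bigcap_(i in [set: 'I_n]) [set x : 'rV[R]_n | `|x ord0 i| <= a]).
  apply: fin_bigcap_measurable => // i _.
  rewrite -[X in measurable X]setTI (_ : [set x | _] =
    (fun x : 'rV[R]_n => x ord0 i) @^-1` `[- a, a]%classic).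
    exact: measurable_rV_coor.
  by apply/seteqP; split => x /=; rewrite in_itv/= ler_norml.
by apply/seteqP; split => x /= h i; [move=> _|]; exact: h.
Qed.

Lemma lebesgue_rV_box n a : 0 <= a ->
  (lebesgue_rV R n (@rV_box n a) = ((2 * a) ^+ n)%:E)%E.
Proof.
move=> a0; elim: n => [|n IH].
  rewrite /= diracE expr0 mem_set//; by case.
rewrite /= /image_measure /pushforward.
rewrite (_ : _ @^-1` _ = @rV_box n a `*` `[- a, a]%classic); last first.
  apply/seteqP; split => [[x t]/= h|[x t] /= [h +] i]; rewrite in_itv/= -ler_norml.
    split=> [i|].
      by have := h (@rshift 1 n i); rewrite /rV_cons (@row_mxEr _ 1 1 n).
    by have := h (@lshift 1 n ord0); rewrite /rV_cons (@row_mxEl _ 1 1 n) mxE.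
  move=> ta; rewrite /rV_cons; case: (@split_ordP 1 n i) => j ->.
    by rewrite (@row_mxEl _ 1 1 n) mxE.
  by rewrite (@row_mxEr _ 1 1 n).
rewrite product_measure1E//; last exact: measurable_rV_box.
rewrite IH; transitivity (((2 * a) ^+ n)%:E * mu `[(- a)%R, a]%classic)%E => //.
rewrite lebesgue_measure_itv/= lte_fin -EFinB.
have [aa|] := ltrP (- a) a.
  by rewrite -EFinM exprSr; congr (_ * _)%:E; ring.
move=> aa; have -> : a = 0 by lra.
by rewrite mule0 mulr0 exprS mul0r.
Qed.

Lemma coor_le_norm n (x : 'rV[R]_n) i : `|x ord0 i| <= `|x|.
Proof.
by rewrite {2}/Num.norm/= mx_normrE; exact: (le_bigmax _ (fun ij => `|x ij.1 ij.2|) (ord0, i)).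
Qed.

Lemma norm_lt_coor n (x : 'rV[R]_n) (e : R) : 0 < e ->
  (forall i, `|x ord0 i| < e) -> `|x| < e.
Proof.
move=> e0 h; rewrite /Num.norm/= mx_normrE; apply/bigmax_ltP; split => // -[i j] _ /=.
by rewrite (ord1 i).
Qed.

Lemma rV_le_bound n (x : 'rV[R]_n) : exists m : nat, rV_box m%:R x.
Proof.
exists (Num.truncn `|x|).+1 => i; apply: (le_trans (coor_le_norm x i)).
by rewrite ltW//; exact: Num.Theory.truncnS_gt.
Qed.

Lemma sigma_finite_lebesgue_rV n : sigma_finite setT (lebesgue_rV R n).
Proof.
exists (fun m : nat => @rV_box n m%:R).
  by apply/seteqP; split => // x _; have [m] := rV_le_bound x; exists m.
move=> m; split; first exact: measurable_rV_box.
by rewrite lebesgue_rV_box// ltry.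
Qed.

(* [lebesgue_rV R n] is already a bundled measure: this alias is a constant to
   which the sigma-finite structure can be attached. *)
Definition lebesgue_sf n (A : set 'rV[R]_n) : \bar R := lebesgue_rV R n A.

HB.instance Definition _ n := isMeasure.Build _ _ _ (@lebesgue_sf n)
  (measure0 (lebesgue_rV R n)) (measure_ge0 (lebesgue_rV R n))
  (@measure_semi_sigma_additive _ _ _ (lebesgue_rV R n)).

HB.instance Definition _ n := Measure_isSigmaFinite.Build _ _ _ (@lebesgue_sf n)
  (@sigma_finite_lebesgue_rV n).

Lemma tonelli_rV n (f : 'rV[R]_n * measurableTypeR R -> \bar R) :
  measurable_fun setT f -> (forall z, 0 <= f z)%E ->
  (\int[lebesgue_rV R n]_x \int[mu]_t f (x, t) =
   \int[mu]_t \int[lebesgue_rV R n]_x f (x, t))%E.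
Proof.
move=> mf f0.
exact: (@fubini_tonelli _ _ _ _ R (@lebesgue_sf n) mu f).
Qed.

Lemma tonelli_rV1 n (f : 'rV[R]_n * measurableTypeR R -> \bar R) :
  measurable_fun setT f -> (forall z, 0 <= f z)%E ->
  (\int[lebesgue_rV R n \x mu]_z f z =
   \int[lebesgue_rV R n]_x \int[mu]_t f (x, t))%E.
Proof.
move=> mf f0.
exact: (@fubini_tonelli1 _ _ _ _ R (@lebesgue_sf n) mu f).
Qed.

Lemma integral_rV_cons n (f : 'rV[R]_n.+1 -> \bar R) :
  measurable_fun setT f -> (forall x, 0 <= f x)%E ->
  (\int[lebesgue_rV R n.+1]_x f x =
   \int[lebesgue_rV R n]_x \int[mu]_t f (rV_cons (x, t)))%E.
Proof.
move=> mf f0.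
rewrite /= /image_measure ge0_integral_pushforward//=.
rewrite preimage_setT.
rewrite (@tonelli_rV1 n (fun z => f (rV_cons z)))//.
by apply: measurableT_comp => //; exact: measurable_rV_cons.
Qed.

(** The image of Lebesgue measure under [t |-> l t + b], multiplied by [l], gives half-open
    intervals their length, so it is Lebesgue measure by uniqueness. *)
Lemma ge0_integral_affine (l b : R) (f : R -> \bar R) : 0 < l ->
  measurable_fun setT f -> (forall x, 0 <= f x)%E ->
  (\int[mu]_t f (l * t + b)%R = l^-1%:E * \int[mu]_t f t)%E.
Proof.
move=> l0 mf f0.
have maff : measurable_fun [set: measurableTypeR R]
    ((fun t => l * t + b) : _ -> measurableTypeR R).
  by apply: measurable_funD => //; exact: measurable_funM.
pose g : measurableTypeR R -> measurableTypeR R := fun t => l * t + b.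
pose k : {nonneg R} := NngNum (ltW l0).
have E A : measurable A -> mu A = mscale k (pushforward mu g) A.
  move=> mA; pose h : {mfun measurableTypeR R >-> measurableTypeR R} :=
    HB.pack g (isMeasurableFun.Build _ _ _ _ g maff).
  apply: (@lebesgue_measure_unique R (mscale k (image_measure mu h))) => //.
  move=> _ [[u v]] _ <-; rewrite /mscale/= /image_measure/= /pushforward/=.
  transitivity (l%:E * mu `]((u - b) / l)%R, ((v - b) / l)%R]%classic)%E; last first.
    rewrite /mscale/=; congr (_ * _)%E; congr (mu _).
    apply/seteqP; split=> t /=; rewrite /g !in_itv/= ltr_pdivrMr// ler_pdivlMr//;
      by rewrite ltrBlDr lerBrDr mulrC.
  rewrite !lebesgue_measure_itv/= !lte_fin ltr_pM2r ?invr_gt0// ltrD2r.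
  case: ifPn => _; last by rewrite mule0.
  rewrite -!EFinB -EFinM/=; congr EFin; field; exact: lt0r_neq0.
have -> : (\int[mu]_t f t = l%:E * \int[mu]_t f (g t))%E.
  pose h : {mfun measurableTypeR R >-> measurableTypeR R} :=
    HB.pack g (isMeasurableFun.Build _ _ _ _ g maff).
  rewrite (@eq_measure_integral _ _ _ _ (mscale k (image_measure mu h))).
    rewrite ge0_integral_mscale//= /image_measure ge0_integral_pushforward//=.
  by move=> A mA _; exact: (E maff A mA).
by rewrite muleA -EFinM mulVf ?gt_eqF// mul1e.
Qed.

Lemma measurable_rV_affine n (l : R) (b : 'rV[R]_n) :
  measurable_fun setT (fun x : 'rV[R]_n => l *: x + b).
Proof.
apply: measurable_fun_rVP => i; under eq_fun do rewrite !mxE.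
by apply: measurable_funD => //; apply: measurable_funM => //;
  exact: measurable_rV_coor.
Qed.

(** Induction on the dimension: Tonelli splits off one coordinate, which contributes one factor
    [l^-1]. The general affine form covers the dilations of [integral_rays] and the translations of
    [integral_translate]. *)
Lemma ge0_integral_rV_affine n (l : R) (b : 'rV[R]_n) (f : 'rV[R]_n -> \bar R) :
  0 < l -> measurable_fun setT f -> (forall x, 0 <= f x)%E ->
  (\int[lebesgue_rV R n]_x f (l *: x + b)%R =
   (l ^- n)%:E * \int[lebesgue_rV R n]_x f x)%E.
Proof.
move=> l0; elim: n b f => [|n IH] b f mf f0.
  rewrite expr0 invr1 mul1e; apply: eq_integral => x _; congr f.
  by apply/rowP => -[].
have mfb : measurable_fun setT (fun x : 'rV[R]_n.+1 => f (l *: x + b)).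
  by apply: measurableT_comp => //; exact: measurable_rV_affine.
rewrite !integral_rV_cons//.
pose b' : 'rV[R]_n := @rsubmx _ 1 1 n b.
pose b0 : R := b ord0 ord0.
have bE (x : 'rV[R]_n) (t : R) : l *: rV_cons (x, t) + b = rV_cons (l *: x + b', (l * t + b0)%R).
  apply/rowP => i; rewrite 2!mxE /rV_cons /=; case: (@split_ordP 1 n i) => j ->.
    rewrite !(@row_mxEl _ 1 1 n) !mxE; congr (_ + b _ _).
    by apply/val_inj; rewrite /= ord1.
  by rewrite !(@row_mxEr _ 1 1 n) !mxE.
have mF : measurable_fun setT (fun z : 'rV[R]_n * measurableTypeR R => f (rV_cons z)).
  by apply: measurableT_comp => //; exact: measurable_rV_cons.
have mft x : measurable_fun setT (fun t : measurableTypeR R => f (rV_cons (x, t))).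
  exact: (measurableT_comp mF (measurable_pair1 _)).
pose F (x : 'rV[R]_n) : \bar R := (\int[mu]_t f (rV_cons (x, t)))%E.
pose F' (x : 'rV[R]_n) : \bar R := F (l *: x + b').
transitivity (\int[lebesgue_rV R n]_x (l^-1%:E * F' x))%E.
  apply: eq_integral => x _.
  under eq_integral do rewrite bE.
  exact: (@ge0_integral_affine l b0 (fun t => f (rV_cons (l *: x + b', t))) l0 (mft _) (fun t => f0 _)).
have mI : measurable_fun setT F.
  exact: (@measurable_fun_fubini_tonelli_F _ _ _ _ R mu _ mF (fun z => f0 _)).
have F0 x : (0 <= F x)%E by exact: integral_ge0.
rewrite (ge0_integralZl_EFin _ measurableT); last 3 first.
- by move=> x _; exact: F0.
- exact: (measurableT_comp mI (@measurable_rV_affine n l b')).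
- by rewrite invr_ge0 ltW.
rewrite (IH b' F)//.
by rewrite muleA -EFinM exprS invfM.
Qed.

Lemma measurable_tonelli_rV n (f : 'rV[R]_n * measurableTypeR R -> \bar R) :
  measurable_fun setT f -> (forall z, 0 <= f z)%E ->
  measurable_fun setT (fun x => \int[mu]_t f (x, t))%E.
Proof. by move=> mf f0; exact: measurable_fun_fubini_tonelli_F. Qed.

(** Measurability refers to the sigma-algebra of the coordinates, so openness has to be reduced to
    it: an open set is a countable union of open cubes with rational centers and radii [1/(k+1)]. *)
Lemma measurable_open_rV n (U : set 'rV[R]_n) : open U -> measurable U.
Proof.
move=> oU.
pose B (q : 'rV[rat]_n) (k : nat) : set 'rV[R]_n :=
  [set y | forall i, `|y ord0 i - ratr (q ord0 i)| < k.+1%:R^-1].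
pose I := [set u : 'rV[rat]_n * nat | B u.1 u.2 `<=` U].
have mB q k : measurable (B q k).
  rewrite (_ : B q k = \bigcap_(i in [set: 'I_n])
      [set y : 'rV[R]_n | `|y ord0 i - ratr (q ord0 i)| < k.+1%:R^-1]).
    apply: fin_bigcap_measurable => // i _.
    rewrite -[X in measurable X]setTI (_ : [set x | _] =
      (fun x : 'rV[R]_n => x ord0 i) @^-1`
        `](ratr (q ord0 i) - k.+1%:R^-1), (ratr (q ord0 i) + k.+1%:R^-1)[%classic).
      exact: measurable_rV_coor.
    by apply/seteqP; split => x /=; rewrite in_itv/= ltr_distl.
  by apply/seteqP; split => x /= h i; [move=> _|]; exact: h.
have -> : U = \bigcup_(u in I) B u.1 u.2.
  apply/seteqP; split => [x Ux|x [u Iu Bux]]; last exact: Iu.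
  have /nbhs_ballP[e /= e0 eU] : nbhs x U by exact: open_nbhs_nbhs.
  (* Twice the radius, because [x] and a point of the cube are compared through the rational
     center. *)
  have [k ke] : exists k : nat, k.+1%:R^-1 * 2 < e.
    exists (Num.truncn (2 / e)).
    rewrite mulrC ltr_pdivrMr// mulrC -ltr_pdivrMr//; exact: Num.Theory.truncnS_gt.
  have hq i : exists q : rat, `|x ord0 i - ratr q| < k.+1%:R^-1.
    have /rat_in_itvoo[q] : x ord0 i - k.+1%:R^-1 < x ord0 i + k.+1%:R^-1.
      by rewrite ltrD2l gtrN.
    by rewrite in_itv/= => hq; exists q; rewrite distrC ltr_distl.
  exists ((\row_i xchoose (hq i)), k) => /=.
    move=> y /= By; apply: eU; rewrite mx_norm_ball /ball_/=.
    apply: norm_lt_coor => // i; rewrite !mxE.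
    have := By i; rewrite mxE; have := xchooseP (hq i) => xi yi.
    rewrite -(subrK (ratr (xchoose (hq i))) (x _ _)) -addrA.
    apply: (le_lt_trans (ler_normD _ _)); apply: (le_lt_trans _ ke).
    by rewrite mulr_natr mulr2n lerD// ltW// distrC.
  by move=> i; rewrite mxE; exact: xchooseP (hq i).
rewrite bigcup_set_type; apply: countable_bigcupT_measurable.
  exact: countableP.
by move=> u; exact: mB.
Qed.

Lemma continuous_measurable_rV n (f : 'rV[R]_n -> R) :
  continuous f -> measurable_fun setT f.
Proof.
move=> /continuousP cf; apply: (measurability _ (RGenOpens.measurableE R)).
move=> _ [_ [a [b ->]] <-]; rewrite setTI; apply: measurable_open_rV; apply: cf.
exact: interval_open.
Qed.

End lebesgue_rV_theory.

(** * Euclidean norm, balls and null sets *)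

Section enorm_theory.
Context (R : realType) (N : nat).
Implicit Types (x y : 'rV[R]_N).

Lemma enorm_ge0 x : 0 <= enorm x. Proof. exact: sqrtr_ge0. Qed.

Lemma sqr_enorm x : enorm x ^+ 2 = \sum_(i < N) x ord0 i ^+ 2.
Proof. by rewrite sqr_sqrtr// sumr_ge0// => i _; exact: sqr_ge0. Qed.

Lemma enormZ (a : R) x : enorm (a *: x) = `|a| * enorm x.
Proof.
rewrite /enorm -sqrtr_sqr -sqrtrM ?sqr_ge0//; congr Num.sqrt.
by rewrite mulr_sumr; apply: eq_bigr => i _; rewrite mxE exprMn.
Qed.

Lemma enormN x : enorm (- x) = enorm x.
Proof. by rewrite -scaleN1r enormZ normrN1 mul1r. Qed.

Lemma enorm0 : enorm (0 : 'rV[R]_N) = 0.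
Proof. by rewrite -(scale0r 0) enormZ normr0 mul0r. Qed.

Lemma enorm_coor x i : `|x ord0 i| <= enorm x.
Proof.
rewrite -sqrtr_sqr /enorm ler_wsqrtr// (bigD1 i)//= lerDl sumr_ge0// => j _.
exact: sqr_ge0.
Qed.

Lemma enorm_eq0 x : enorm x = 0 -> x = 0.
Proof.
move=> x0; apply/rowP => i; rewrite mxE; apply/eqP; rewrite -normr_le0 -x0.
exact: enorm_coor.
Qed.

Lemma enorm_gt0 x : x != 0 -> 0 < enorm x.
Proof.
move=> x0; rewrite lt_neqAle enorm_ge0 andbT eq_sym.
by apply: contra_neq x0 => /enorm_eq0.
Qed.

(** Cauchy-Schwarz: the squared norm of [|x|^2 y - s x], with [s] the scalar product, is nonnegative
    and factors as [|x|^2 (|x|^2 |y|^2 - s^2)]. *)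
Lemma dot_le_enorm x y :
  `|\sum_(i < N) x ord0 i * y ord0 i| <= enorm x * enorm y.
Proof.
set s := \sum_(i < N) _.
have [x0|x0] := eqVneq x 0.
  rewrite /s x0 big1 ?normr0 ?mulr_ge0 ?enorm_ge0// => i _.
  by rewrite mxE mul0r.
have ex0 : 0 < enorm x ^+ 2 by rewrite exprn_gt0// enorm_gt0.
have : 0 <= enorm (enorm x ^+ 2 *: y - s *: x) ^+ 2 by exact: sqr_ge0.
have -> : enorm (enorm x ^+ 2 *: y - s *: x) ^+ 2 =
  (enorm x ^+ 2) * (enorm x ^+ 2 * enorm y ^+ 2 - s ^+ 2).
  rewrite sqr_enorm; under eq_bigr do rewrite !mxE.
  transitivity (\sum_(i < N) ((enorm x ^+ 2)^+2 * y ord0 i ^+ 2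
     - 2 * s * enorm x ^+ 2 * (x ord0 i * y ord0 i) + s ^+ 2 * x ord0 i ^+ 2)).
    by apply: eq_bigr => i _; ring.
  rewrite big_split sumrB -!mulr_sumr -!sqr_enorm -/s /=; ring.
rewrite pmulr_rge0// subr_ge0 -exprMn -(real_normK (num_real s)) => h.
by rewrite -(ler_pXn2r (n := 2))// nnegrE// mulr_ge0// enorm_ge0.
Qed.

Lemma enormD x y : enorm (x + y) <= enorm x + enorm y.
Proof.
rewrite -(ler_pXn2r (n := 2))// ?nnegrE ?addr_ge0 ?enorm_ge0//.
rewrite sqr_enorm sqrrD !sqr_enorm.
under eq_bigr do rewrite mxE sqrrD.
rewrite !big_split/= lerD2r lerD2l -mulr2n lerMn2r/=.
exact: le_trans (ler_norm _) (dot_le_enorm _ _).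
Qed.

Lemma eball_box rho : eball N rho `<=` @rV_box R N rho.
Proof. by move=> x /= xr i; rewrite (le_trans (enorm_coor _ _))// ltW. Qed.

Lemma box_eball (a rho : R) : 0 <= a -> N%:R * a < rho -> @rV_box R N a `<=` eball N rho.
Proof.
move=> a0 ar x xa; apply: le_lt_trans ar.
rewrite -(ler_pXn2r (n := 2))// ?nnegrE ?enorm_ge0 ?mulr_ge0//.
rewrite sqr_enorm; apply: (@le_trans _ _ (\sum_(i < N) a ^+ 2)).
  by apply: ler_sum => i _; rewrite -real_normK ?num_real ?ler_pXn2r// nnegrE.
rewrite sumr_const card_ord exprMn -[_ *+ N]mulr_natl ler_wpM2r ?sqr_ge0//.
by rewrite -natrX ler_nat; case: (N) => // n; rewrite expnS leq_pmulr.
Qed.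

Lemma eball_lty rho : (lebesgue_rV R N (eball N rho) < +oo)%E.
Proof.
have [r0|r0] := leP 0 rho.
  apply: le_lt_trans (ltry ((2 * rho) ^+ N)); rewrite -lebesgue_rV_box//.
  apply: le_measure; rewrite ?inE; [exact: measurable_eball|exact: measurable_rV_box|].
  exact: eball_box.
rewrite (_ : eball N rho = set0) ?measure0//.
by apply/seteqP; split => // x /= /(le_lt_trans (enorm_ge0 x)); rewrite ltNge ltW.
Qed.

Lemma eball_gt0 (rho : R) : 0 < rho -> (0 < lebesgue_rV R N (eball N rho))%E.
Proof.
move=> r0; pose a := rho / N.+1%:R.
have a0 : 0 < a by rewrite divr_gt0.
apply: (@lt_le_trans _ _ (lebesgue_rV R N (@rV_box R N a))).
  by rewrite lebesgue_rV_box ?ltW// lte_fin exprn_gt0// mulr_gt0.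
apply: le_measure; rewrite ?inE; [exact: measurable_rV_box|exact: measurable_eball|].
apply: box_eball; first exact: ltW.
by rewrite mulrCA gtr_pMr// ltr_pdivrMr// mul1r ltr_nat.
Qed.

Lemma measurable_rV_set1 x : measurable [set x].
Proof.
rewrite (_ : [set x] = \bigcap_(i in [set: 'I_N]) [set y : 'rV[R]_N | y ord0 i = x ord0 i]).
  apply: fin_bigcap_measurable => // i _.
  rewrite -[X in measurable X]setTI (_ : [set y | _] =
      (fun y : 'rV[R]_N => y ord0 i) @^-1` [set x ord0 i]) //.
  exact: measurable_rV_coor.
apply/seteqP; split => y /= => [-> //|h]; apply/rowP => i; exact: h.
Qed.

(** The origin lies in cubes of arbitrarily small volume. Dimension 0 is excluded, since the measure
    there is the Dirac mass at the origin. *)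
Lemma lebesgue_rV_set0 : (0 < N)%N -> lebesgue_rV R N [set 0] = 0%E.
Proof.
move=> N0.
have h k : (lebesgue_rV R N [set 0%R] <= ((2 * k.+1%:R^-1) ^+ N)%:E)%E.
  rewrite -lebesgue_rV_box//.
  apply: le_measure; rewrite ?inE; [exact: measurable_rV_set1|exact: measurable_rV_box|].
  by move=> _ -> i; rewrite mxE normr0.
apply/eqP; rewrite eq_le measure_ge0 andbT.
apply/lee_addgt0Pr => e e0; rewrite add0e.
(* Capping at 1 makes the [N]-th power of the side at most the side itself. *)
pose m := Num.min e 1.
have [m0 m1 me] : [/\ 0 < m, m <= 1 & m <= e].
  by rewrite /m lt_min e0 ltr01 !ge_min !lexx orbT.
apply: (le_trans (h (Num.truncn (2 / m)))); rewrite lee_fin.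
have km : 2 * (Num.truncn (2 / m)).+1%:R^-1 <= m.
  rewrite ler_pdivrMr// mulrC -ler_pdivrMr// ltW//; exact: Num.Theory.truncnS_gt.
apply: (le_trans _ me); apply: (le_trans _ km); apply: (le_trans _ (_ : _ ^+ 1 <= _)).
  by apply: ler_wiXn2l; rewrite ?mulr_ge0 ?(le_trans km).
by rewrite expr1.
Qed.

End enorm_theory.

(** * Calculus rules for real-valued functions along a direction *)

Section derivatives.
Context (R : realType) (V : normedModType R).
Implicit Types (f g : V -> R) (x v : V).

Lemma is_derive_const (c : R) x v : is_derive x v (fun=> c) (0 : R).
Proof. exact: is_derive_cst. Qed.

Lemma is_derive_mul f g x v (df dg : R) :
  is_derive x v f df -> is_derive x v g dg ->
  is_derive x v (fun y => f y * g y) (df * g x + f x * dg).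
Proof.
move=> dfx dgx; rewrite addrC [df * _]mulrC.
exact: (@is_deriveM R V f g x v df dg).
Qed.

Lemma is_derive_scale f x v (c df : R) :
  is_derive x v f df -> is_derive x v (fun y => c * f y) (c * df).
Proof.
by move=> dfx; exact: (@is_deriveZ R V R^o f c x v df).
Qed.

Lemma is_derive_add f g x v (df dg : R) :
  is_derive x v f df -> is_derive x v g dg ->
  is_derive x v (fun y => f y + g y) (df + dg).
Proof. by move=> dfx dgx; exact: (@is_deriveD R V R^o f g x v df dg). Qed.

Lemma is_derive_exprn f x v (df : R) n : is_derive x v f df ->
  is_derive x v (fun y => f y ^+ n) (n%:R * f x ^+ n.-1 * df).
Proof.
move=> dfx; have -> : (fun y => f y ^+ n) = f ^+ n.
  by apply/funext => y; rewrite exprfctE.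
exact: (@is_deriveX R V f n x v df).
Qed.

Lemma is_derive_inv f x v (df : R) : f x != 0 -> is_derive x v f df ->
  is_derive x v (fun y => (f y)^-1) (- (f x ^- 2) * df).
Proof.
move=> fx0 dfx; have dfv := @ex_derive _ _ _ _ _ _ _ dfx.
apply: DeriveDef; first exact: derivableV.
by rewrite deriveV// (@derive_val _ _ _ _ _ _ _ dfx).
Qed.

(** Turns a directional derivative into a one-variable derivative at 0, to which the one-variable
    chain rule applies. *)
Lemma is_derive_dir f x v (df : R) :
  is_derive x v f df <-> is_derive (0 : R) 1 (fun h : R => f (h *: v + x)) df.
Proof.
have E : 'D_v f x = 'D_1 (fun h : R => f (h *: v + x)) 0.
  rewrite /derive; set g1 := fun h => h^-1 *: _; set g2 := fun h => h^-1 *: _.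
  suff -> : g1 = g2 by [].
  by rewrite funeqE /g1 /g2 => h /=; rewrite addr0 scale0r add0r [_%:A]mulr1.
have [h1 h2] := derivable1P f x v.
by split => -[d <-]; split; [exact: h1|exact: esym E|exact: h2|exact: E].
Qed.

Lemma is_derive_comp f (g : R -> R) x v (df dg : R) :
  is_derive (f x) 1 g dg -> is_derive x v f df ->
  is_derive x v (g \o f) (dg * df).
Proof.
move=> dgx /is_derive_dir dfx; apply/is_derive_dir.
rewrite [X in is_derive _ _ X _](_ : _ = g \o (fun h : R => f (h *: v + x)))//.
by apply: is_derive1_comp; rewrite scale0r add0r.
Qed.

Lemma is_derive_continuous (h : R -> R) (t : R) (dh : R) :
  is_derive t 1 h dh -> {for t, continuous h}.
Proof. by move=> -[dt _]; exact/differentiable_continuous/derivable1_diffP. Qed.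

End derivatives.

Section powers.
Context (R : realType).
Implicit Types (p t : R).

Lemma cvg_exprn_pinfty (n : nat) : (t ^+ n.+1 : R) @[t --> +oo] --> +oo.
Proof.
apply/cvgryPge => A; near=> t.
have t1 : 1 <= t by near: t; apply: nbhs_pinfty_ge; exact: num_real.
apply: (@le_trans _ _ t); first by near: t; apply: nbhs_pinfty_ge; exact: num_real.
by apply: ler_eXnr.
Unshelve. all: by end_near. Qed.

End powers.

(** * Integration along rays *)

Section rays.
Context (R : realType).
Local Notation mu := (@lebesgue_measure R).

(** With [N = n.+1], the exponent [n.+2] is that of the weight [1/t] times the Jacobian factor
    [t^-N] of the dilation by [t]. *)
Lemma integral_powers (n : nat) (a : R) : 0 < a ->
  (\int[mu]_(t in `[a, +oo[) (t ^- n.+2)%:E = ((n.+1%:R * a ^+ n.+1)^-1)%:E)%E.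
Proof.
move=> a0; pose F (t : R) : R := - n.+1%:R^-1 * t ^- n.+1.
have dF t : a <= t -> is_derive t (1 : R) F (t ^- n.+2).
  move=> at0; have t0 : t != 0 by rewrite gt_eqF// (lt_le_trans a0).
  have d1 := is_derive_exprn n.+1 (is_derive_id t (1 : R)).
  have d2 := @is_derive_inv _ _ (fun t : R => t ^+ n.+1) t 1 _ (expf_neq0 _ t0) d1.
  apply: (is_derive_eq (is_derive_scale (- n.+1%:R^-1) d2)).
  rewrite /= mulr1 -exprM mulnC.
  have n0 : n.+1%:R != 0 :> R by rewrite pnatr_eq0.
  rewrite (_ : (2 * n.+1)%N = (n + n.+2)%N); last by rewrite mul2n -addnn addSnnS.
  have : t ^+ n != 0 by exact: expf_neq0.
  rewrite exprD !exprS; move: (_ ^+ n) (_.+1%:R) n0 => u c n0 u0; field.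
  by rewrite u0 t0 n0.
have cvF t : a <= t -> {for t, continuous F}.
  by move=> /dF; exact: is_derive_continuous.
have -> : ((n.+1%:R * a ^+ n.+1)^-1)%:E = (0%:E - (F a)%:E)%E :> \bar R.
  by rewrite add0e; congr EFin; rewrite /F mulNr opprK invfM.
apply: (@ge0_continuous_FTC2y _ (fun t => t ^- n.+2) F a 0).
- by move=> t at0; rewrite invr_ge0 exprn_ge0// (le_trans _ at0)// ltW.
- apply: continuous_in_subspaceT => t; rewrite inE/= in_itv/= andbT => at0.
  apply: cvgV; first by rewrite expf_neq0// gt_eqF// (lt_le_trans a0).
  exact: exprn_continuous.
- rewrite -(mulr0 (- n.+1%:R^-1)); apply: cvgM; first exact: cvg_cst.
  apply/gtr0_cvgV0; last exact: cvg_exprn_pinfty.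
  by near=> t; rewrite exprn_gt0//; near: t; apply: nbhs_pinfty_gt; exact: num_real.
- by move=> t at0; have := dF t (ltW at0) => -[].
- by apply: cvg_at_right_filter; exact: cvF.
- move=> t; rewrite in_itv/= andbT => /ltW /dF dt; rewrite derive1E; exact: derive_val.
Unshelve. all: by end_near. Qed.

Lemma mem_itvcy (a t : R) : (t \in `[a, +oo[%classic) = (a <= t).
Proof. by apply/idP/idP; rewrite inE/= in_itv/= andbT. Qed.

(* The sharp trace inequality uses [a = 1]; in [trace_hole] the rays start at the
   hole, that is at [t = r / |x|], so [a = r / rho]. *)
Definition ray_fun n (a : R) (F : 'rV[R]_n -> \bar R)
    (z : 'rV[R]_n * measurableTypeR R) : \bar R :=
  ((if a <= z.2 then (z.2 : R)^-1 else 0)%:E * F ((z.2 : R) *: z.1))%E.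

Section ray_fun.
Context (n : nat) (a : R) (F : 'rV[R]_n -> \bar R).
Hypotheses (a0 : 0 < a) (mF : measurable_fun setT F) (F0 : forall x, (0 <= F x)%E).

Lemma ray_fun_ge0 z : (0 <= ray_fun a F z)%E.
Proof.
rewrite mule_ge0// lee_fin; case: ifP => // at0.
by rewrite invr_ge0 (le_trans _ at0)// ltW.
Qed.

Lemma measurable_ray_fun : measurable_fun setT (ray_fun a F).
Proof.
have mk : measurable_fun [set: R] (fun t : R => if a <= t then t^-1 else 0).
  apply: measurable_fun_ifT => //; first exact: measurable_fun_ler.
  exact: measurable_inv.
have mZ : measurable_fun setT
    (fun z : 'rV[R]_n * measurableTypeR R => (z.2 : R) *: z.1).
  apply: measurable_fun_rVP => i; under eq_fun do rewrite mxE.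
  apply: measurable_funM; first exact: measurable_snd.
  exact: (measurableT_comp (@measurable_rV_coor R n i) measurable_fst).
apply: emeasurable_funM; last exact: (measurableT_comp mF mZ).
by apply/measurable_EFinP; exact: (measurableT_comp mk measurable_snd).
Qed.

Lemma integral_ray_fun (x : 'rV[R]_n) :
  (\int[mu]_(t in `[a, +oo[) ((t^-1)%:E * F (t *: x)) =
   \int[mu]_t ray_fun a F (x, t))%E.
Proof.
rewrite [LHS]integral_mkcond; apply: eq_integral => t _.
by rewrite patchE /ray_fun /= mem_itvcy; case: ifPn => // _; rewrite mul0e.
Qed.

Lemma measurable_ray : measurable_fun setT (fun x : 'rV[R]_n =>
    \int[mu]_(t in `[a, +oo[) ((t^-1)%:E * F (t *: x)))%E.
Proof.
under eq_fun do rewrite integral_ray_fun.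
apply: measurable_tonelli_rV; [exact: measurable_ray_fun|exact: ray_fun_ge0].
Qed.

End ray_fun.

Lemma integral_rays n (a : R) (F : 'rV[R]_n.+1 -> \bar R) : 0 < a ->
  measurable_fun setT F -> (forall x, 0 <= F x)%E ->
  (\int[lebesgue_rV R n.+1]_x \int[mu]_(t in `[a, +oo[) ((t^-1)%:E * F (t *: x)) =
   ((n.+1%:R * a ^+ n.+1)^-1)%:E * \int[lebesgue_rV R n.+1]_x F x)%E.
Proof.
move=> a0 mF F0.
under eq_integral do rewrite integral_ray_fun.
rewrite tonelli_rV//; first last.
- exact: ray_fun_ge0.
- exact: measurable_ray_fun.
set I := (\int[lebesgue_rV R n.+1]_x F x)%E.
have I0 : (0 <= I)%E by exact: integral_ge0.
transitivity (\int[mu]_(t in `[a, +oo[) ((t ^- n.+2)%:E * I))%E.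
  rewrite [RHS]integral_mkcond; apply: eq_integral => t _.
  rewrite patchE /ray_fun /= mem_itvcy; case: ifPn => [at0|_].
    have t0 : 0 < t := lt_le_trans a0 at0.
    transitivity ((t^-1)%:E * \int[lebesgue_rV R n.+1]_x F (t *: x + 0)%R)%E.
      rewrite -ge0_integralZl_EFin//; last by rewrite invr_ge0 ltW.
        by apply: eq_integral => x _; rewrite addr0.
      exact: (measurableT_comp mF (@measurable_rV_affine R n.+1 t 0)).
    by rewrite ge0_integral_rV_affine// muleA -EFinM -invfM -exprS.
  by apply: integral0_eq => x _; rewrite mul0e.
rewrite ge0_integralZr//.
- by rewrite integral_powers.
- apply/measurable_EFinP/measurable_funTS.
  apply: (@measurableT_comp _ _ _ _ _ _ (@GRing.inv R)); first exact: measurable_inv.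
  exact: exprn_measurable.
- move=> t; rewrite /= in_itv/= andbT => at0.
  by rewrite lee_fin invr_ge0 exprn_ge0// (le_trans _ at0)// ltW.
Qed.

Lemma ge0_integral_mrestr d (T : measurableType d)
    (m : {measure set T -> \bar R}) (D E : set T) (mD : measurable D)
    (f : T -> \bar R) :
  measurable E -> measurable_fun E f -> (forall x, E x -> 0 <= f x)%E ->
  (\int[mrestr m mD]_(x in E) f x = \int[m]_(x in E `&` D) f x)%E.
Proof.
move=> mE mf f0; have mED := measurableI _ _ mE mD.
have mE'D := measurableD mE mD.
rewrite -{1}(setUIDK E D) ge0_integral_setU//=; last 3 first.
- by rewrite setUIDK.
- by move=> x [[Ex _]|[Ex _]]; exact: f0.
- rewrite disj_set2E; apply/eqP/seteqP; split => x //= [[_ Dx] [_ nDx]].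
  exact: nDx.
rewrite [X in (_ + X)%E](null_set_integral mE'D) ?adde0//; last 2 first.
- by apply: measurable_funS mf => //; exact: subIsetl.
- rewrite /= /mrestr (_ : _ `&` _ = set0) ?measure0//.
  by apply/seteqP; split => x //= [[_ nDx] Dx]; exact: nDx.
by apply: eq_measure_integral => A mA; rewrite subsetI /= /mrestr => -[_ /setIidPl ->].
Qed.

Lemma surface_integral N (rho : R) (g : 'rV[R]_N -> \bar R) : 0 < rho ->
  measurable_fun setT g -> (forall x, 0 <= g x)%E ->
  (\int[surface N rho]_(x in esphere N rho) g x =
   (N%:R / rho)%:E *
   \int[lebesgue_rV R N]_(x in eball N rho `\ 0%R) g ((rho / enorm x) *: x)%R)%E.
Proof.
move=> rho0 mg g0.
have mS : measurable (esphere N rho).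
  rewrite -[X in measurable X]setTI (_ : esphere N rho = @enorm R N @^-1` [set rho])//.
  exact: (@measurable_enorm R N).
rewrite /surface ge0_integral_mscale//=; last exact: measurable_funTS.
rewrite ger0_norm; last by rewrite divr_ge0 ?ler0n ?ltW.
congr (_ * _)%E.
rewrite /image_measure ge0_integral_pushforward//=; last exact: measurable_funTS.
have mp : measurable_fun [set: 'rV[R]_N] (sphere_proj rho).
  exact: measurable_sphere_proj.
rewrite ge0_integral_mrestr//=; first last.
- by apply: measurable_funTS; exact: measurableT_comp.
- by rewrite -[X in measurable X]setTI; exact: mp.
(* The projection sends the origin to itself (whatever the value of [rho / 0]), hence off the
   sphere, and every other point onto the sphere; this is why the ball is punctured. *)
rewrite (_ : _ `&` _ = eball N rho `\ 0)//.
apply/seteqP; split => x /=; rewrite /sphere_proj /esphere/= enormZ.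
  move=> [r0 xr]; split => // x0; move: r0; rewrite x0 enorm0 mulr0 => /eqP.
  by rewrite lt_eqF//.
move=> [xr /eqP x0]; split => //.
by rewrite ger0_norm ?divfK ?gt_eqF ?enorm_gt0// divr_ge0// ?enorm_ge0// ltW.
Qed.

End rays.

(** * Directional derivatives *)

Section chain_rule.
Context (R : realType) (V : normedModType R).
Implicit Types (f : V -> R) (x y u v : V).

Lemma is_derive_line f y v (s : R) : derivable f (s *: v + y) v ->
  is_derive s 1 (fun s : R => f (s *: v + y)) ('D_v f (s *: v + y)).
Proof.
move=> /derivableP /is_derive_dir df; apply/is_derive_dir.
rewrite [X in is_derive _ _ X _](_ : _ = fun h : R => f (h *: v + (s *: v + y)))//.
by apply/funext => h; rewrite addrA -scalerDl; congr (f (_ *: _ + _)); rewrite [_%:A]mulr1.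
Qed.

(** The intermediate point is controlled by [|c| <= |h|] instead of being placed between 0 and [h],
    which treats both signs of [h] and [h = 0] at once. *)
Lemma MVT_line f y v (h : R) : (forall x, derivable f x v) ->
  exists2 c : R, `|c| <= `|h| & f (h *: v + y) - f y = h * 'D_v f (c *: v + y).
Proof.
move=> df; pose g (s : R) := f (s *: v + y).
have dg (s : R) : is_derive s 1 g ('D_v f (s *: v + y)) by exact/is_derive_line/df.
have cg : continuous g by move=> s; exact: is_derive_continuous (dg s).
have g0 : g 0 = f y by rewrite /g scale0r add0r.
have [h0|h0|->] := ltgtP h 0.
- have [c] := MVT h0 (fun s _ => dg s) (continuous_subspaceT cg).
  rewrite in_itv/= => /andP[hc c0] E; exists c.
    by rewrite !ltr0_norm// lerN2 ltW.
  by move: E; rewrite g0 /g => E; rewrite -[LHS]opprB E; ring.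
- have [c] := MVT h0 (fun s _ => dg s) (continuous_subspaceT cg).
  rewrite in_itv/= => /andP[c0 hc] E; exists c.
    by rewrite !gtr0_norm// ltW.
  by move: E; rewrite g0 /g => ->; ring.
by exists 0; rewrite // scale0r add0r subrr mul0r.
Qed.

(* Only one of the two directional derivatives has to be continuous: the increment
   along [v] is evaluated by the mean value theorem, the one along [u] at [x]. *)
Lemma is_derive_add_dir f x u v : derivable f x u ->
  (forall y, derivable f y v) -> {for x, continuous ('D_v f)} ->
  is_derive x (u + v) f ('D_u f x + 'D_v f x).
Proof.
move=> dfu dfv cv.
have cvg : h^-1 *: ((f \o shift x) (h *: (u + v)) - f x) @[h --> 0^'] -->
    ('D_u f x + 'D_v f x : R).
  have -> : (fun h : R => h^-1 *: ((f \o shift x) (h *: (u + v)) - f x)) =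
    (fun h => h^-1 *: ((f \o shift x) (h *: u) - f x) +
       h^-1 *: (f (h *: v + (h *: u + x)) - f (h *: u + x))).
    apply/funext => h /=; rewrite -scalerDr; congr (_ *: _).
    by rewrite scalerDr -addrA addrCA [RHS]addrC [RHS]addrA subrK.
  apply: cvgD; first exact: dfu.
  apply/cvgrPdist_le => e e0.
  have /cvgrPdist_le /(_ e e0) /nbhs_ballP[d /= d0 dP] := cv.
  near=> h.
  have h0 : h != 0 by near: h; exact: nbhs_dnbhs_neq.
  have [c ch ->] := MVT_line (h *: u + x) h dfv.
  rewrite /GRing.scale/= mulKf//; apply: dP.
  rewrite -ball_normE /ball_/= opprD opprD addrCA [x + _]addrCA subrr addr0 -opprD normrN.
  apply: (le_lt_trans (ler_normD _ _)); rewrite !normrZ.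
  apply: (@le_lt_trans _ _ (`|h| * (`|v| + `|u|))).
    by rewrite mulrDr lerD2r ler_wpM2r.
  have k0 : 0 < `|v| + `|u| + 1 by rewrite ltr_wpDl// addr_ge0.
  apply: (@le_lt_trans _ _ (`|h| * (`|v| + `|u| + 1))).
    by rewrite ler_wpM2l// lerDl.
  rewrite -ltr_pdivlMr//; near: h; apply: dnbhs0_lt; exact: divr_gt0.
by split; [apply/cvg_ex; exists ('D_u f x + 'D_v f x)|exact: cvg_lim cvg].
Unshelve. all: by end_near. Qed.

Lemma is_derive_scale_dir f x v (c : R) : derivable f x v ->
  is_derive x (c *: v) f (c * 'D_v f x).
Proof.
move=> /derivableP /is_derive_dir df; apply/is_derive_dir.
rewrite [X in is_derive _ _ X _](_ : _ =
   (fun h : R => f (h *: v + x)) \o (fun h : R => c * h)); last first.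
  by apply/funext => h /=; rewrite scalerA mulrC.
rewrite mulrC -[X in _ * X]mulr1; apply: is_derive_comp; rewrite mulr0; exact: df.
Qed.

End chain_rule.

Section gradient.
Context (R : realType) (N : nat).
Implicit Types (phi : 'rV[R]_N -> R) (x v : 'rV[R]_N).

(** The direction [v] is built up from its coordinate components, one at a time, by
    [is_derive_add_dir]; continuity of each partial derivative is what that lemma asks of the added
    direction. *)
Lemma is_derive_grad phi x v :
  (forall i y, derivable phi y (delta_mx ord0 i)) ->
  (forall i, continuous (partial i phi)) ->
  is_derive x v phi (\sum_(i < N) v ord0 i * grad phi x ord0 i).
Proof.
move=> d c; rewrite {1}(row_sum_delta v).
under [X in is_derive _ _ _ X]eq_bigr do rewrite mxE /partial.
elim: (index_enum _) => [|i s IH]; first by rewrite !big_nil; exact: is_derive0.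
rewrite !big_cons addrC [X in is_derive _ _ _ X]addrC.
have dZ y := @is_derive_scale_dir R _ phi y (delta_mx ord0 i) (v ord0 i) (d i y).
have E : 'D_(v ord0 i *: delta_mx ord0 i) phi = (fun y => v ord0 i * partial i phi y).
  by apply/funext => y; have [_ ->] := dZ y.
apply: is_derive_eq.
  apply: is_derive_add_dir.
  - by case: IH.
  - by move=> y; case: (dZ y).
  - by rewrite E; apply: continuousM; [exact: cst_continuous|exact: c].
by congr (_ + _); [case: IH|case: (dZ x)].
Qed.

Lemma smooth_continuous phi : smooth phi -> continuous phi.
Proof. by move=> /(_ [::])[]. Qed.

Lemma smooth_partial phi i : smooth phi -> smooth (partial i phi).
Proof. by move=> sp s; have := sp (rcons s i); rewrite foldr_rcons. Qed.

Lemma smooth_derivable phi i x : smooth phi -> derivable phi x (delta_mx ord0 i).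
Proof. by move=> /(_ [::])[_]; exact. Qed.

Lemma is_derive_smooth phi x v : smooth phi ->
  is_derive x v phi (\sum_(i < N) v ord0 i * grad phi x ord0 i).
Proof.
move=> sp; apply: is_derive_grad => [i y|i]; first exact: smooth_derivable.
exact/smooth_continuous/smooth_partial.
Qed.

Lemma smoothB phi psi : smooth phi -> smooth psi -> smooth (fun x => phi x - psi x).
Proof.
move=> sp sq s.
have E : foldr (@partial R N) (fun x => phi x - psi x) s =
    (fun x => foldr (@partial R N) phi s x - foldr (@partial R N) psi s x).
  elim: s => //= i s ->; apply/funext => x; rewrite /partial.
  by apply: (@deriveB _ _ R^o); [exact: (sp s).2|exact: (sq s).2].
have [cp dp] := sp s; have [cq dq] := sq s.
rewrite E; split => [x|i x]; first by apply: continuousB; [exact: cp|exact: cq].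
by apply: (@derivableB _ _ R^o); [exact: dp|exact: dq].
Qed.

Lemma gradB phi psi x : smooth phi -> smooth psi ->
  grad (fun x => phi x - psi x) x = grad phi x - grad psi x.
Proof.
move=> sp sq; apply/rowP => i; rewrite !mxE /partial.
by apply: (@deriveB _ _ R^o); exact: smooth_derivable.
Qed.

Lemma measurable_smooth phi : smooth phi -> measurable_fun setT phi.
Proof. by move=> /smooth_continuous; exact: continuous_measurable_rV. Qed.

Lemma measurable_grad phi : smooth phi -> measurable_fun setT (grad phi).
Proof.
move=> sp; apply: measurable_fun_rVP => i; under eq_fun do rewrite mxE.
apply: (@measurable_smooth (partial i phi)); exact: smooth_partial.
Qed.

End gradient.

(** * Trace inequalities *)

Section signed_power.
Context (R : realType).
Implicit Types (a p t : R).
Local Notation mu := (@lebesgue_measure R).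

(** The odd power function: for [a = p - 1] it is the derivative of [|t|^p] divided by [p]. *)
Definition spow a t : R := Num.sg t * `|t| `^ a.

Lemma normr_spow a t : a != 0 -> `|spow a t| = `|t| `^ a.
Proof.
move=> a0; rewrite normrM (ger0_norm (powR_ge0 _ _)) normr_sg.
by have [->|t0] := eqVneq t 0; rewrite ?mul1r// normr0 powR0// mulr0.
Qed.

Lemma cvg_powR0 a : 0 < a -> (`|t| `^ a : R) @[t --> (0 : R)] --> (0 : R).
Proof.
move=> a0; apply/cvgrPdist_lt => e e0; apply/nbhs_ballP.
exists (e `^ a^-1) => /=; first exact: powR_gt0.
move=> t; rewrite /ball/= sub0r normrN => te.
rewrite sub0r normrN ger0_norm ?powR_ge0//.
have -> : e = (e `^ a^-1) `^ a by rewrite -powRrM mulVf ?gt_eqF// powRr1// ltW.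
by rewrite gt0_ltr_powR// nnegrE ?powR_ge0.
Qed.

(** Away from 0 this is the usual power rule. At 0 the difference quotient has absolute value
    [|h|^(p-1)], which tends to 0 because [p > 1]. *)
Lemma is_derive_powR_norm p t : 1 < p ->
  is_derive t 1 (fun t : R => `|t| `^ p) (p * spow (p - 1) t).
Proof.
move=> p1; rewrite /spow; have [t0|t0|->] := ltgtP t 0.
- rewrite ltr0_sg// ltr0_norm//.
  apply: (@near_eq_is_derive _ _ _ (fun s => (- s) `^ p)); last 1 first.
  + apply: is_derive_eq.
      apply: (@is_derive_comp _ _ (fun s : R => - s) (fun s => s `^ p)).
      apply: is_derive1_powR; by rewrite oppr_gt0.
    by rewrite mulrN1 mulN1r mulrN.
  + by near=> s; rewrite ltr0_norm//; near: s; exact: lt_nbhsl.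
- rewrite gtr0_sg// gtr0_norm// mul1r.
  apply: (@near_eq_is_derive _ _ _ (fun s => s `^ p)); last exact: is_derive1_powR.
  by near=> s; rewrite gtr0_norm//; near: s; exact: lt_nbhsr.
rewrite sgr0 mul0r mulr0.
have p10 : 0 < p - 1 by rewrite subr_gt0.
have cvg : h^-1 *: (((fun t : R => `|t| `^ p) \o shift 0) (h *: (1 : R)) - `|0 : R| `^ p)
    @[h --> (0 : R)^'] --> (0 : R).
  apply/cvgrPdist_lt => e e0.
  have /cvgrPdist_lt/(_ e e0) P := cvg_powR0 p10.
  near=> h.
  have h0 : h != 0 by near: h; exact: nbhs_dnbhs_neq.
  rewrite /= addr0 [_ *: 1]mulr1 normr0 powR0 ?subr0; last by rewrite gt_eqF// (lt_trans ltr01).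
  rewrite sub0r normrN normrZ normfV (ger0_norm (powR_ge0 _ _)).
  rewrite -(@mulr_powRB1 _ _ p)// ?(lt_trans ltr01)// mulKf ?normr_eq0//.
  rewrite -[X in X < _]ger0_norm ?powR_ge0// -normrN -sub0r.
  near: h; exact: nbhs_dnbhs.
by split; [apply/cvg_ex; exists 0|exact: cvg_lim cvg].
Unshelve. all: by end_near. Qed.

Lemma continuous_spow a : 0 < a -> continuous (spow a).
Proof.
move=> a0 t; rewrite /spow; have [t0|t0|->] := ltgtP t 0.
- apply: (@cvg_trans _ ((- (- s) `^ a) @[s --> t])).
    apply: near_eq_cvg; apply: filterS (lt_nbhsl t0) => s s0.
    by rewrite ltr0_sg// ltr0_norm// mulN1r.
  rewrite ltr0_sg// ltr0_norm// mulN1r.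
  have dp : is_derive (- t) 1 (fun s => s `^ a) (a * (- t) `^ (a - 1)).
    by apply: is_derive1_powR; rewrite oppr_gt0.
  have cp : {for t, continuous (fun s => (- s) `^ a)}.
    apply: (@continuous_comp _ _ _ (fun s : R => - s) (fun s : R => s `^ a)); first exact: opp_continuous.
    exact: is_derive_continuous dp.
  exact: (continuousN cp).
- apply: (@cvg_trans _ (s `^ a @[s --> t])).
    apply: near_eq_cvg; apply: filterS (lt_nbhsr t0) => s s0.
    by rewrite gtr0_sg// gtr0_norm// mul1r.
  rewrite gtr0_sg// gtr0_norm// mul1r.
  exact: (is_derive_continuous (is_derive1_powR a t0)).
rewrite /continuous_at sgr0 mul0r; apply: norm_cvg0.
have -> : (fun s => `|Num.sg s * `|s| `^ a|) = (fun s => `|s| `^ a).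
  by apply/funext => s; rewrite normr_spow// gt_eqF.
exact: cvg_powR0.
Unshelve. all: by end_near. Qed.

(** Young's inequality for the factors [k y] and [x^(p-1) / k] with [k = K^(1/p)]: [k] cancels in
    the product and leaves [K] and [K^(-1/(p-1))] on the right. *)
Lemma young_powR p K (x y : R) : 1 < p -> 0 < K -> 0 <= x -> 0 <= y ->
  p * (x `^ (p - 1) * y) <= K * y `^ p + (p - 1) * K `^ (- (p - 1)^-1) * x `^ p.
Proof.
move=> p1 K0 x0 y0; have p0 : 0 < p by exact: lt_trans p1.
have p10 : 0 < p - 1 by rewrite subr_gt0.
pose q := p / (p - 1); have q0 : 0 < q by rewrite divr_gt0.
pose k := K `^ p^-1; have k0 : 0 < k by rewrite powR_gt0.
have pq : p^-1 + q^-1 = 1 by rewrite /q invf_div; field; rewrite gt_eqF.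
have := @conjugate_powR R (k * y) (k^-1 * x `^ (p - 1)) p q _ _ p0 q0 pq.
rewrite !mulr_ge0 ?invr_ge0 ?powR_ge0 ?(ltW k0)// => /(_ isT isT).
rewrite [k * y * _](_ : _ = x `^ (p - 1) * y); last by field; rewrite gt_eqF.
rewrite powRM ?(ltW k0)// powRM ?powR_ge0 ?invr_ge0 ?(ltW k0)//.
have -> : k `^ p = K by rewrite /k -powRrM mulVf ?gt_eqF// powRr1// ltW.
have -> : k^-1 `^ q = K `^ (- (p - 1)^-1).
  rewrite /k -powRN -powRrM; congr (_ `^ _); rewrite /q; field.
  by rewrite !gt_eqF.
rewrite -(powRrM x) (_ : (p - 1) * q = p); last by rewrite /q mulrC divfK ?gt_eqF.
move=> h; rewrite -ler_pdivlMl//; apply: (le_trans h); rewrite mulrDr lerD//.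
  by rewrite mulrC.
rewrite le_eqVlt; apply/orP; left; apply/eqP; rewrite /q; field.
by rewrite !gt_eqF.
Qed.

(** The bound is asked only on the half-open interval: at the end of a ray the point is on the
    sphere, outside the open ball to which the energy density is cut off. *)
Lemma FTC_le (F dF h : R -> R) a b : a < b ->
  (forall t, t \in `[a, b] -> is_derive t 1 F (dF t)) ->
  {in `[a, b], continuous dF} ->
  measurable_fun `[a, b[ h -> (forall t, t \in `[a, b[ -> 0 <= h t) ->
  (forall t, t \in `[a, b[ -> dF t <= h t) ->
  ((F b)%:E <= (F a)%:E + \int[mu]_(t in `[a, b[) (h t)%:E)%E.
Proof.
move=> ab DF cdF mh h0 dFh.
have ab' t : t \in `]a, b[ -> t \in `[a, b] by apply: subset_itv_oo_cc.
have aa : a \in `[a, b] by rewrite in_itv/= lexx ltW.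
have bb : b \in `[a, b] by rewrite in_itv/= lexx ltW.
have cs : {within `[a, b], continuous dF}.
  by apply: continuous_in_subspaceT => t; rewrite inE/=; exact: cdF.
have E : (\int[mu]_(t in `[a, b]) (dF t)%:E = (F b)%:E - (F a)%:E)%E.
  apply: continuous_FTC2 => //; last first.
    by move=> t /ab' tab; rewrite derive1E; have [_] := DF t tab.
  split; first by move=> t /ab' tab; have [] := DF t tab.
    by apply: cvg_at_right_filter; exact: is_derive_continuous (DF a aa).
  by apply: cvg_at_left_filter; exact: is_derive_continuous (DF b bb).
have mdF : measurable_fun `[a, b] dF by exact: subspace_continuous_measurable_fun.
have mdF' : measurable_fun `[a, b[ dF.
  by apply: measurable_funS mdF => //; apply: subset_itv_co_cc.
have -> : (F b)%:E = ((F a)%:E + \int[mu]_(t in `[a, b]) (dF t)%:E)%E.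
  by rewrite E addeC subeK.
rewrite leeD2l// -integral_itv_bndo_bndc; last exact/measurable_EFinP.
rewrite integralE; apply: (@le_trans _ _ (\int[mu]_(t in `[a, b[) (EFin \o dF)^\+ t)%E).
  by rewrite geeDl// oppe_le0 integral_ge0.
apply: ge0_le_integral => //.
- exact/measurable_funepos/measurable_EFinP.
- exact/measurable_EFinP.
- move=> t tab; rewrite funeposE/= ge_max !lee_fin; rewrite h0//andbT; exact: dFh.
Qed.

End signed_power.

Section trace.
Context (R : realType) (n : nat).
Local Notation N := n.+1.
Local Notation mu := (@lebesgue_measure R).
Local Notation leb := (lebesgue_rV R N).
Implicit Types (phi : 'rV[R]_N -> R) (x y : 'rV[R]_N) (p rho : R).

(** Integrates a pointwise ray estimate over the punctured ball: [A] carries the value at the start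
    of the ray, [H] the density along it. The rays run to infinity, so [H] is integrated over the
    whole space and has to contain its own cut-off. *)
Lemma boundary_energy_le_rays p rho a phi (A H : 'rV[R]_N -> \bar R) :
  0 < rho -> 0 < a -> measurable_fun setT phi ->
  measurable_fun setT A -> (forall x, 0 <= A x)%E ->
  measurable_fun setT H -> (forall x, 0 <= H x)%E ->
  (forall x, eball N rho x -> x != 0 ->
     ((`|phi ((rho / enorm x) *: x)%R| `^ p)%:E <=
      A x + \int[mu]_(t in `[a, +oo[) ((t^-1)%:E * H (t *: x)))%E) ->
  (boundary_energy p rho phi <=
   (N%:R / rho)%:E * (\int[leb]_(x in eball N rho) A x +
     ((N%:R * a ^+ N)^-1)%:E * \int[leb]_x H x))%E.
Proof.
move=> rho0 a0 mphi mA A0 mH H0 le.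
have mg : measurable_fun setT (fun y => (`|phi y| `^ p)%:E).
  by apply/measurable_EFinP; apply: measurableT_comp (measurable_powR _) _;
    exact: measurableT_comp.
rewrite /boundary_energy surface_integral//.
rewrite lee_pmul2l//; last by rewrite lte_fin divr_gt0.
have mB : measurable (eball N rho `\ (0 : 'rV[R]_N)).
  by apply: measurableD; [exact: measurable_eball|exact: measurable_rV_set1].
have mray := measurable_ray a0 mH H0.
have ray0 x : (0 <= \int[mu]_(t in `[a, +oo[) ((t^-1)%:E * H (t *: x)))%E.
  apply: integral_ge0 => t; rewrite /= in_itv/= andbT => at0.
  by rewrite mule_ge0// lee_fin invr_ge0 (le_trans _ at0)// ltW.
pose G x : \bar R := (\int[mu]_(t in `[a, +oo[) ((t^-1)%:E * H (t *: x)))%E.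
pose AG x : \bar R := (A x + G x)%E.
set B := eball N rho `\ 0 in mB *.
refine (@le_trans _ _ (\int[leb]_(x in B) AG x)%E _ _ _ _).
  apply: ge0_le_integral => //.
  - apply: measurable_funTS; apply: measurableT_comp mg _.
    exact: measurable_sphere_proj.
  - by apply: measurable_funTS; exact: emeasurable_funD.
  - by move=> x /= [xr /eqP x0]; exact: le.
rewrite ge0_integralD//; try exact: measurable_funTS.
  rewrite leeD//.
    apply: ge0_subset_integral => //; first exact: measurable_eball.
      exact: measurable_funTS.
    by move=> x [].
  rewrite -integral_rays//; apply: ge0_subset_integral => // x _; exact: ray0.
by move=> x _; exact: ray0.
Qed.

(** On [[s, rho / |x|[] the cut-off equals 1, and extending the integral to [[a, +oo[] only
    increases it. The start [s] may depend on [x], while [integral_rays] needs the common bound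
    [a]. *)
Lemma ray_FTC (F dF : R -> R) (H : 'rV[R]_N -> R) x a s rho :
  x != 0 -> 0 < a -> a <= s -> s < rho / enorm x ->
  (forall t, t \in `[s, (rho / enorm x)] -> is_derive t 1 F (dF t)) ->
  {in `[s, (rho / enorm x)], continuous dF} ->
  measurable_fun setT H -> (forall y, 0 <= H y) ->
  (forall t, t \in `[s, (rho / enorm x)[ -> dF t <= t^-1 * H (t *: x)) ->
  ((F (rho / enorm x))%:E <= (F s)%:E + \int[mu]_(t in `[a, +oo[)
     ((t^-1)%:E * (H (t *: x)%R * \1_(eball N rho) (t *: x)%R)%:E))%E.
Proof.
move=> x0 a0 as_ sT DF cdF mH H0 dFH.
have s0 : 0 < s := lt_le_trans a0 as_.
have mx : measurable_fun [set: R] (fun t : R => t *: x).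
  apply: measurable_fun_rVP => i; under eq_fun do rewrite mxE.
  exact: measurable_funM.
have mi : measurable_fun [set: R] (fun t : R => t^-1) by exact: measurable_inv.
have mh : measurable_fun [set: R] (fun t => t^-1 * H (t *: x)).
  by apply: measurable_funM => //; exact: measurableT_comp.
have t0 t : t \in `[s, (rho / enorm x)[ -> 0 < t.
  by rewrite in_itv/= => /andP[st _]; exact: lt_le_trans st.
have h0 t : t \in `[s, (rho / enorm x)[ -> 0 <= t^-1 * H (t *: x).
  by move=> /t0 t0'; rewrite mulr_ge0// invr_ge0 ltW.
apply: (le_trans (FTC_le sT DF cdF (measurable_funTS mh) h0 dFH)).
rewrite leeD2l//.
pose h2 t := ((t^-1)%:E * (H (t *: x)%R * \1_(eball N rho) (t *: x)%R)%:E)%E.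
refine (@le_trans _ _ (\int[mu]_(t in `[s, (rho / enorm x)%R[) h2 t)%E _ _ _ _).
  rewrite le_eqVlt; apply/orP; left; apply/eqP.
  apply: eq_integral => t; rewrite inE/= => tin; rewrite /h2.
  have t0' := t0 _ tin; rewrite indicE mem_set ?mulr1 ?EFinM//=.
  rewrite /eball/= enormZ gtr0_norm// -ltr_pdivlMr ?enorm_gt0//.
  by move: tin; rewrite in_itv/= => /andP[].
apply: ge0_subset_integral => //.
- apply: measurable_funTS; apply: emeasurable_funM; first exact/measurable_EFinP.
  apply/measurable_EFinP; apply: measurable_funM; first exact: measurableT_comp.
  apply: measurableT_comp mx; apply: measurable_indic; exact: measurable_eball.
- move=> t; rewrite /= in_itv/= andbT => at0; rewrite mule_ge0// lee_fin.
    by rewrite invr_ge0 (le_trans _ at0)// ltW.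
  by rewrite mulr_ge0.
- move=> t; rewrite /= !in_itv/= andbT => /andP[st _]; exact: le_trans st.
Qed.

Definition ray_slope phi x y : R := \sum_(i < N) x ord0 i * grad phi y ord0 i.

Lemma is_derive_ray p phi x (t : R) : 1 < p -> smooth phi ->
  is_derive t 1 (fun t => `|phi (t *: x)| `^ p)
    (p * spow (p - 1) (phi (t *: x)) * ray_slope phi x (t *: x)).
Proof.
move=> p1 sp.
apply: (@is_derive_comp _ _ (fun t : R => phi (t *: x)) (fun s => `|s| `^ p)).
  exact: is_derive_powR_norm.
have d := is_derive_smooth (t *: x) x sp.
have -> : (fun t : R => phi (t *: x)) = (fun t : R => phi (t *: x + 0)).
  by apply/funext => u; rewrite addr0.
rewrite /ray_slope -(addr0 (t *: x)) in d *; have [dx <-] := d.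
exact: is_derive_line.
Qed.

Lemma continuous_ray phi x : continuous phi -> continuous (fun t : R => phi (t *: x)).
Proof.
move=> cp t; apply: (@continuous_comp _ _ _ (fun t : R => t *: x) phi); last exact: cp.
exact: scalel_continuous.
Qed.

Lemma continuous_ray_derive p phi x : 1 < p -> smooth phi ->
  continuous (fun t : R => p * spow (p - 1) (phi (t *: x)) * ray_slope phi x (t *: x)).
Proof.
move=> p1 sp t.
have c1 : {for t, continuous (fun t : R => spow (p - 1) (phi (t *: x)))}.
  apply: (@continuous_comp _ _ _ (fun t : R => phi (t *: x)) (spow (p - 1))).
    exact/continuous_ray/smooth_continuous.
  by apply: continuous_spow; rewrite subr_gt0.
have c2 : {for t, continuous (fun t : R => ray_slope phi x (t *: x))}.
  apply: (@continuous_ray (ray_slope phi x)) => y; rewrite /ray_slope.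
  apply: cvg_big => [||i _]; [exact: add_continuous|exact: (@nbhs_filter 'rV[R]_N)|].
  rewrite (_ : (fun y => _) = fun y => x ord0 i * partial i phi y); last first.
    by apply/funext => z; rewrite mxE.
  have cq : {for y, continuous (partial i phi)}.
    exact: (smooth_continuous (smooth_partial i sp)).
  by rewrite mxE; exact: (cvgM (cvg_cst (x ord0 i)) cq).
exact: (cvgM (cvgM (cvg_cst p) c1) c2).
Qed.

(** The slope along the ray is at most [|x| |grad phi|], and [|x| <= rho / t] inside the ball; this
    produces the weight [1/t] that [integral_rays] expects. Young's inequality does the rest. *)
Lemma ray_derive_le p K rho phi x (t : R) : 1 < p -> 0 < K -> 0 < t ->
  t * enorm x <= rho ->
  p * spow (p - 1) (phi (t *: x)) * ray_slope phi x (t *: x) <=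
  t^-1 * (rho * (K * enorm (grad phi (t *: x)) `^ p +
    (p - 1) * K `^ (- (p - 1)^-1) * `|phi (t *: x)| `^ p)).
Proof.
move=> p1 K0 t0 tx; set y := t *: x.
have p0 : 0 < p by exact: lt_trans p1.
have p10 : p - 1 != 0 by rewrite subr_eq0 gt_eqF.
have Y := young_powR p1 K0 (normr_ge0 (phi y)) (enorm_ge0 (grad phi y)).
apply: (@le_trans _ _ (enorm x * (p * (`|phi y| `^ (p - 1) * enorm (grad phi y))))).
  apply: (le_trans (ler_norm _)); rewrite normrM normrM normr_spow// gtr0_norm//.
  rewrite [leRHS](_ : _ = p * `|phi y| `^ (p - 1) * (enorm x * enorm (grad phi y))).
    by rewrite ler_wpM2l ?mulr_ge0 ?powR_ge0 ?(ltW p0)//; exact: dot_le_enorm.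
  by ring.
apply: (@le_trans _ _ (t^-1 * rho * (p * (`|phi y| `^ (p - 1) * enorm (grad phi y))))).
  rewrite ler_wpM2r ?mulr_ge0 ?powR_ge0 ?enorm_ge0 ?(ltW p0)//.
  by rewrite mulrC ler_pdivlMr// mulrC.
rewrite -mulrA ler_wpM2l ?invr_ge0 ?(ltW t0)// ler_wpM2l//.
by rewrite (le_trans _ tx)// mulr_ge0 ?enorm_ge0// ltW.
Qed.

End trace.

Section trace_inequalities.
Context (R : realType) (n : nat).
Local Notation N := n.+1.
Local Notation leb := (lebesgue_rV R N).
Implicit Types (phi : 'rV[R]_N -> R) (x y : 'rV[R]_N) (p rho : R).

Lemma integral_indic_ball rho (f : 'rV[R]_N -> R) :
  (\int[leb]_x (f x * \1_(eball N rho) x)%:E = \int[leb]_(x in eball N rho) (f x)%:E)%E.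
Proof.
rewrite [RHS]integral_mkcond; apply: eq_integral => x _.
by rewrite patchE indicE; case: ifPn => _; rewrite ?mulr1// mulr0.
Qed.

Lemma measurable_normpow (f : 'rV[R]_N -> R) p : measurable_fun setT f ->
  measurable_fun setT (fun x => `|f x| `^ p).
Proof.
by move=> mf; apply: measurableT_comp (measurable_powR _) _; exact: measurableT_comp.
Qed.

Lemma measurable_enormpow (g : 'rV[R]_N -> 'rV[R]_N) p : measurable_fun setT g ->
  measurable_fun setT (fun x => enorm (g x) `^ p).
Proof.
move=> mg; apply: measurableT_comp (measurable_powR _) _.
exact: (measurableT_comp (@measurable_enorm R N)).
Qed.

(* The weight in Young's inequality that makes the coefficients of [|grad phi|^p]
   and of [|phi|^p] equal. *)
Definition trace_cst p : R := (p - 1) `^ ((p - 1) / p).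

Lemma trace_cst_gt0 p : 1 < p -> 0 < trace_cst p.
Proof. by move=> p1; rewrite powR_gt0// subr_gt0. Qed.

Lemma trace_cstE p : 1 < p ->
  (p - 1) * trace_cst p `^ (- (p - 1)^-1) = trace_cst p.
Proof.
move=> p1; have p0 : 0 < p by exact: lt_trans p1.
have p10 : 0 < p - 1 by rewrite subr_gt0.
rewrite /trace_cst -powRrM (_ : _ * - _ = - p^-1); last by field; rewrite !gt_eqF.
rewrite -{1}(powRr1 (ltW p10)) -powRD; last by rewrite (gt_eqF p10) implybT.
by congr (_ `^ _); field; rewrite gt_eqF.
Qed.

Lemma trace_smooth p rho phi : 1 < p -> 0 < rho -> smooth phi ->
  (boundary_energy p rho phi <=
   (trace_cst p + N%:R / rho)%:E * energy p (eball N rho) phi (grad phi))%E.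
Proof.
move=> p1 rho0 sp; have K0 := trace_cst_gt0 p1.
have mphi := measurable_smooth sp.
have mgrad := measurable_grad sp.
set K := trace_cst p in K0 *.
pose e y := enorm (grad phi y) `^ p + `|phi y| `^ p.
pose H y := rho * (K * e y).
have e0 y : 0 <= e y by rewrite addr_ge0 ?powR_ge0.
have H0 y : 0 <= H y by rewrite !mulr_ge0// ltW.
have me : measurable_fun setT e.
  by apply: measurable_funD; [exact: measurable_enormpow|exact: measurable_normpow].
have mH : measurable_fun setT H by do 2 apply: measurable_funM => //.
have mB := @measurable_eball R N rho.
have mHB : measurable_fun setT (fun y => (H y * \1_(eball N rho) y)%:E).
  apply/measurable_EFinP; apply: measurable_funM => //; exact: measurable_indic.
have HB0 x : (0 <= (H x * \1_(eball N rho) x)%:E)%E by rewrite lee_fin mulr_ge0.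
have mA : measurable_fun setT (fun x => (`|phi x| `^ p)%:E).
  apply/measurable_EFinP; exact: measurable_normpow.
have A0 x : (0 <= (`|phi x| `^ p)%:E)%E by rewrite lee_fin powR_ge0.
have h := boundary_energy_le_rays rho0 ltr01 mphi mA A0 mHB HB0.
refine (@le_trans _ _ _ _ _ (h _ _) _) => {h}.
  move=> x xB x0; have ex := enorm_gt0 x0.
  have T1 : 1 < rho / enorm x by rewrite ltr_pdivlMr// mul1r.
  pose F t := `|phi (t *: x)| `^ p.
  (* The ray starts at [x] itself, so the initial value [|phi x|^p] is the term [A]. *)
  have := @ray_FTC R n F _ H x 1 1 rho x0 ltr01 (lexx _) T1
    (fun t _ => is_derive_ray x t p1 sp) _ mH H0 _.
  rewrite /F scale1r; apply.
    by move=> t _; exact: continuous_ray_derive.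
  move=> t; rewrite in_itv/= => /andP[t1 tT].
  have t0 : 0 < t := lt_le_trans ltr01 t1.
  have tx : t * enorm x <= rho by rewrite -ler_pdivlMr// ltW.
  apply: (le_trans (ray_derive_le phi p1 K0 t0 tx)).
  by rewrite /H /e trace_cstE// -mulrDr.
rewrite integral_indic_ball expr1n mulr1 /energy.
set E := (\int[leb]_(x in _) (enorm _ `^ _ + _)%:E)%E.
have -> : (\int[leb]_(x in eball N rho) (H x)%:E = (rho * K)%:E * E)%E.
  rewrite -ge0_integralZl_EFin//; last by rewrite mulr_ge0// ltW.
  - by apply: eq_integral => x _; rewrite -EFinM /H mulrA.
  - by move=> x _; rewrite lee_fin; exact: e0.
  - apply/measurable_EFinP; exact: measurable_funTS.
(* Bounding the initial term by the full energy gives the summand [N / rho]; the rays give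
   [(N / rho) (1 / N) (rho K) = K]. *)
apply: (@le_trans _ _ ((N%:R / rho)%:E * (E + (N%:R^-1)%:E * ((rho * K)%:E * E)))%E).
  rewrite lee_pmul2l//; last by rewrite lte_fin divr_gt0.
  rewrite leeD2r//; apply: ge0_le_integral => //.
  - apply/measurable_EFinP; apply: measurable_funTS; exact: measurable_normpow.
  - apply/measurable_EFinP; exact: measurable_funTS.
  - by move=> x _; rewrite lee_fin lerDr powR_ge0.
rewrite muleA -EFinM -{1}(mul1e E) -ge0_muleDl//; last first.
  by rewrite lee_fin !mulr_ge0// ltW.
rewrite muleA -EFinD -EFinM le_eqVlt; apply/orP; left; apply/eqP; congr (_%:E * _)%E.
have n0 : N%:R != 0 :> R by rewrite pnatr_eq0.
move: (n.+1%:R) n0 => c n0; field; by rewrite n0 gt_eqF.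
Qed.

(** Continuity along the ray carries the zero value from the open hole to its boundary, where the
    rays of [trace_hole] start. *)
Lemma vanish_sphere r phi y : 0 < r -> continuous phi ->
  (forall x, eball N r x -> phi x = 0) -> enorm y = r -> phi y = 0.
Proof.
move=> r0 cphi phi0 yr.
have c1 : phi (t *: y) @[t --> (1 : R)^'-] --> phi y.
  apply: cvg_at_left_filter; rewrite -{2}(scale1r y); exact: continuous_ray.
have c0 : phi (t *: y) @[t --> (1 : R)^'-] --> (0 : R).
  apply: cvg_near_cst; near=> t; apply: phi0.
  have t0 : 0 < t by near: t; exact: nbhs_left_gt.
  have t1 : t < 1 by near: t; exact: nbhs_left_lt.
  by rewrite /eball/= enormZ gtr0_norm// yr gtr_pMl//.
exact: (cvg_unique _ c1 c0).
Unshelve. all: by end_near. Qed.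

(** The product rule for [(T / t)^m] times a function with value [u] and slope [d]: the weight
    contributes the negative term [- m u / t]. *)
Lemma weight_slope (T t u d : R) m : t != 0 ->
  T ^+ m * (- (t ^+ m) ^- 2 * (m%:R * t ^+ m.-1 * 1) * u + (t ^+ m)^-1 * d) =
  (T / t) ^+ m * (d - t^-1 * (m%:R * u)).
Proof.
move=> t0; rewrite expr_div_n; case: m => [|k] /=; first by rewrite !expr0; field.
have : t ^+ k != 0 by exact: expf_neq0.
rewrite (exprS t k); move: (T ^+ _) (t ^+ k) (k.+1%:R) => b a l a0; field.
by rewrite a0 t0.
Qed.

(* The weight [t ^- m] makes the [|phi|^p] term of Young's inequality negative
   along each ray, which starts at the hole, where [phi] vanishes. *)
Lemma trace_hole p r rho K m phi : 1 < p -> 0 < r -> r < rho -> 0 < K ->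
  rho * ((p - 1) * K `^ (- (p - 1)^-1)) <= m%:R -> smooth phi ->
  (forall x, eball N r x -> phi x = 0) ->
  (boundary_energy p rho phi <=
   (K * (rho / r) ^+ (m + N))%:E * energy p (eball N rho) phi (grad phi))%E.
Proof.
move=> p1 r0 rrho K0 cm sp phi0; set c := (p - 1) * _ in cm.
have rho0 : 0 < rho := lt_trans r0 rrho.
have a0 : 0 < r / rho by rewrite divr_gt0.
have mphi := measurable_smooth sp.
have mgrad := measurable_grad sp.
pose e y := enorm (grad phi y) `^ p + `|phi y| `^ p.
pose H y := (rho / r) ^+ m * (rho * (K * enorm (grad phi y) `^ p)).
have k0 : 0 <= (rho / r) ^+ m by rewrite exprn_ge0// divr_ge0// ltW.
have H0 y : 0 <= H y by rewrite !mulr_ge0// ?powR_ge0// ltW.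
have me : measurable_fun setT e.
  by apply: measurable_funD; [exact: measurable_enormpow|exact: measurable_normpow].
have mH : measurable_fun setT H.
  by do 3 apply: measurable_funM => //; exact: measurable_enormpow.
have mB := @measurable_eball R N rho.
have mHB : measurable_fun setT (fun y => (H y * \1_(eball N rho) y)%:E).
  apply/measurable_EFinP; apply: measurable_funM => //; exact: measurable_indic.
have HB0 x : (0 <= (H x * \1_(eball N rho) x)%:E)%E by rewrite lee_fin mulr_ge0.
have h := @boundary_energy_le_rays R n p rho (r / rho) phi (fun x => 0%E) _
  rho0 a0 mphi (measurable_cst _) (fun x => lexx _) mHB HB0.
refine (@le_trans _ _ _ _ _ (h _) _) => {h}.
  move=> x xB x0; have ex := enorm_gt0 x0.
  (* The ray crosses the boundary of the hole at [s] and the outer sphere at [T]; [s >= r / rho] for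
     all [x] in the ball. *)
  set T := rho / enorm x; pose s := r / enorm x.
  have s0 : 0 < s by rewrite divr_gt0.
  have sT : s < T by rewrite ltr_pM2r// invr_gt0.
  have T0 : 0 < T := lt_trans s0 sT.
  pose G t := `|phi (t *: x)| `^ p.
  pose dG t := p * spow (p - 1) (phi (t *: x)) * ray_slope phi x (t *: x).
  pose F t := T ^+ m * ((t ^+ m)^-1 * G t).
  pose dF t := T ^+ m * ((- (t ^+ m) ^- 2 * (m%:R * t ^+ m.-1 * 1)) * G t + (t ^+ m)^-1 * dG t).
  have dFP t : t \in `[s, T] -> is_derive t 1 F (dF t).
    rewrite in_itv/= => /andP[st tT]; have t0 : t != 0 by rewrite gt_eqF// (lt_le_trans s0).
    apply: is_derive_scale; apply: is_derive_mul; last exact: is_derive_ray.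
    by apply: is_derive_inv; [exact: expf_neq0|exact: is_derive_exprn].
  have FT : F T = `|phi (T *: x)| `^ p.
    by rewrite /F mulrA mulfV ?mul1r// expf_neq0// gt_eqF.
  have Fs : F s = 0.
    rewrite /F /G (@vanish_sphere r)//; last 2 first.
    - exact: smooth_continuous.
    - by rewrite enormZ gtr0_norm// divfK// gt_eqF.
    by rewrite normr0 powR0 ?mulr0// gt_eqF// (lt_trans ltr01).
  have := @ray_FTC R n F dF H x (r / rho) s rho x0; rewrite -/T FT Fs.
  apply=> //.
  - by rewrite ler_pM2l// lef_pV2// ltW.
  - move=> t; rewrite in_itv/= => /andP[st _].
    have t0 : t != 0 by rewrite gt_eqF// (lt_le_trans s0).
    have cX k : {for t, continuous (fun t : R => t ^+ k)} by exact: exprn_continuous.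
    have cV : {for t, continuous (fun t : R => (t ^+ m)^-1)}.
      by apply: cvgV; [exact: expf_neq0|exact: cX].
    have cV2 : {for t, continuous (fun t : R => - (t ^+ m) ^- 2)}.
      apply: cvgN; apply: cvgV; first by rewrite !expf_neq0.
      by under eq_fun do rewrite -exprM; rewrite -exprM; exact: cX.
    have cG : {for t, continuous G}.
      exact: is_derive_continuous (is_derive_ray x t p1 sp).
    have cdG : {for t, continuous dG} by exact: continuous_ray_derive.
    have cY : {for t, continuous (fun t : R => m%:R * t ^+ m.-1 * 1)}.
      exact: (cvgM (cvgM (cvg_cst _) (cX _)) (cvg_cst _)).
    exact: (cvgM (cvg_cst _) (cvgD (cvgM (cvgM cV2 cY) cG) (cvgM cV cdG))).
  move=> t; rewrite in_itv/= => /andP[st tT].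
  have t0 : 0 < t := lt_le_trans s0 st.
  have tx : t * enorm x <= rho by rewrite -ler_pdivlMr// ltW.
  have := ray_derive_le phi p1 K0 t0 tx; rewrite -/c -/(dG t).
  set g := enorm _ `^ p; set u := `|_| `^ p => dGle.
  have u0 : 0 <= u by exact: powR_ge0.
  have g0 : 0 <= g by exact: powR_ge0.
  have -> : dF t = (T / t) ^+ m * (dG t - t^-1 * (m%:R * u)).
    by apply: weight_slope; rewrite gt_eqF.
  apply: (@le_trans _ _ ((T / t) ^+ m * (t^-1 * (rho * (K * g))))).
    apply: ler_wpM2l; first by rewrite exprn_ge0// divr_ge0// ltW.
    (* The hypothesis [rho c <= m] lets [m u / t] absorb the term [rho c u / t] coming from Young's
       inequality. *)
    rewrite lerBlDr (le_trans dGle)// -mulrDr ler_wpM2l ?invr_ge0 ?(ltW t0)//.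
    by rewrite mulrDr lerD2l mulrA ler_wpM2r.
  rewrite /H mulrCA ler_wpM2l ?invr_ge0 ?(ltW t0)// -/g ler_wpM2r//.
    by rewrite !mulr_ge0// ltW.
  (* Since [t >= s], the weight never exceeds its value [(rho / r)^m] at the start of the ray. *)
  have Tt : T / t <= rho / r.
    rewrite (_ : rho / r = T / s); last by rewrite /T /s; field; rewrite !gt_eqF.
    by rewrite ler_pM2l// lef_pV2.
  by apply: lerXn2r => //; rewrite nnegrE divr_ge0// ltW.
rewrite integral0 add0e integral_indic_ball /energy.
set E := (\int[leb]_(x in _) (enorm _ `^ _ + _)%:E)%E.
have -> : (\int[leb]_(x in eball N rho) (H x)%:E =
    ((rho / r) ^+ m * (rho * K))%:E *
    \int[leb]_(x in eball N rho) (enorm (grad phi x) `^ p)%:E)%E.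
  rewrite -ge0_integralZl_EFin//; last by rewrite !mulr_ge0// ltW.
  - by apply: eq_integral => x _; rewrite -EFinM /H !mulrA.
  - by move=> x _; rewrite lee_fin powR_ge0.
  - apply/measurable_EFinP; apply: measurable_funTS; exact: measurable_enormpow.
rewrite !muleA -!EFinM.
have -> : N%:R / rho * (N%:R * (r / rho) ^+ N)^-1 * ((rho / r) ^+ m * (rho * K)) =
    K * (rho / r) ^+ (m + N).
  rewrite exprD; move: ((rho / r) ^+ m) => k; rewrite !expr_div_n.
  have : rho ^+ N != 0 by rewrite expf_neq0// gt_eqF.
  have : r ^+ N != 0 by rewrite expf_neq0// gt_eqF.
  have : N%:R != 0 :> R by rewrite pnatr_eq0.
  move: (N%:R) (rho ^+ N) (r ^+ N) => d u v d0 v0 u0.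
  by field; rewrite d0 u0 v0 gt_eqF.
rewrite lee_pmul2l//; last by rewrite lte_fin mulr_gt0// exprn_gt0// divr_gt0.
apply: ge0_le_integral => //.
- by move=> x _; rewrite lee_fin powR_ge0.
- apply/measurable_EFinP; apply: measurable_funTS; exact: measurable_enormpow.
- apply/measurable_EFinP; exact: measurable_funTS.
- by move=> x _; rewrite lee_fin lerDl powR_ge0.
Qed.

End trace_inequalities.

(** * Lower bound for the Steklov constant *)

Section closure.
Context (R : realType) (n : nat).
Local Notation N := n.+1.
Implicit Types (phi u v : 'rV[R]_N -> R) (g : 'rV[R]_N -> 'rV[R]_N).
Implicit Types (x y : 'rV[R]_N) (p rho theta : R).

(* An elementary substitute for Minkowski's inequality. *)
Lemma powR_add_split p theta : 0 < p -> 1 < theta ->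
  exists2 C : R, 0 < C & forall a b : R, 0 <= a -> 0 <= b ->
    (a + b) `^ p <= theta * a `^ p + C * b `^ p.
Proof.
move=> p0 th1; have th0 : 0 < theta := lt_trans ltr01 th1.
pose d := theta `^ p^-1 - 1.
have d0 : 0 < d.
  have : 1 `^ p^-1 < theta `^ p^-1.
    by rewrite gt0_ltr_powR ?invr_gt0// nnegrE// ltW.
  by rewrite powR1 subr_gt0.
have dE : (1 + d) `^ p = theta.
  by rewrite /d addrC subrK -powRrM mulVf ?gt_eqF// powRr1// ltW.
have d1 : 0 <= 1 + d by rewrite ler_wpDl// ltW.
have k0 : 0 < 1 + d^-1 by rewrite addr_gt0// invr_gt0.
exists ((1 + d^-1) `^ p) => [|a b a0 b0]; first exact: powR_gt0.
(* Either [b <= d a], and [a + b <= (1 + d) a] with [(1 + d)^p = theta]; or [a <= b / d], and [b]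
   alone controls the sum. *)
have [bda|/ltW dab] := leP b (d * a).
  apply: (@le_trans _ _ (theta * a `^ p)); last by rewrite lerDl mulr_ge0 ?powR_ge0.
  rewrite -dE -powRM//; apply: (ge0_ler_powR (ltW p0)); rewrite ?nnegrE.
  - exact: addr_ge0.
  - exact: mulr_ge0.
  - by rewrite mulrDl mul1r lerD2l.
apply: (@le_trans _ _ ((1 + d^-1) `^ p * b `^ p)).
  rewrite -powRM// ?(ltW k0)//; apply: (ge0_ler_powR (ltW p0)); rewrite ?nnegrE.
  - exact: addr_ge0.
  - by rewrite mulr_ge0// ltW.
  - by rewrite mulrDl mul1r addrC lerD2l mulrC ler_pdivlMr// mulrC.
by rewrite lerDr mulr_ge0 ?powR_ge0 ?(ltW th0).
Qed.

Lemma energy_ge0 p Omega u g : (0 <= energy p Omega u g)%E.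
Proof. by apply: integral_ge0 => x _; rewrite lee_fin addr_ge0// powR_ge0. Qed.

Lemma boundary_energy_ge0 p rho v : (0 <= boundary_energy p rho v)%E.
Proof. by apply: integral_ge0 => x _; rewrite lee_fin powR_ge0. Qed.

Definition split_cst p theta C := 0 < C /\ forall a b : R, 0 <= a -> 0 <= b ->
    (a + b) `^ p <= theta * a `^ p + C * b `^ p.

Lemma measurable_energy_density p (Omega : set 'rV[R]_N) u g :
  measurable_fun Omega u -> measurable_fun Omega g ->
  measurable_fun Omega (fun x => enorm (g x) `^ p + `|u x| `^ p).
Proof.
move=> mu mg; apply: measurable_funD.
  apply: measurableT_comp (measurable_powR _) _.
  exact: (measurableT_comp (@measurable_enorm R N)).
by apply: measurableT_comp (measurable_powR _) _; exact: measurableT_comp.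
Qed.

(** The factor [theta] can be taken arbitrarily close to 1 on the main term, while the large [C]
    falls on an error term; this preserves the constant in [trace_closure]. *)
Lemma energy_split p theta C Omega u g u1 g1 u2 g2 :
  0 < p -> 0 < theta -> split_cst p theta C -> measurable Omega ->
  measurable_fun Omega u -> measurable_fun Omega g ->
  measurable_fun Omega u1 -> measurable_fun Omega g1 ->
  measurable_fun Omega u2 -> measurable_fun Omega g2 ->
  (forall x, `|u x| <= `|u1 x| + `|u2 x|) ->
  (forall x, enorm (g x) <= enorm (g1 x) + enorm (g2 x)) ->
  (energy p Omega u g <=
   theta%:E * energy p Omega u1 g1 + C%:E * energy p Omega u2 g2)%E.
Proof.
move=> p0 th0 [C0 sC] mO mu mg mu1 mg1 mu2 mg2 uu gg.
pose f (u : 'rV[R]_N -> R) (g : 'rV[R]_N -> 'rV[R]_N) x :=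
  (enorm (g x) `^ p + `|u x| `^ p)%:E.
have f0 u' g' x : (0 <= f u' g' x)%E by rewrite lee_fin addr_ge0// powR_ge0.
have mf u' g' : measurable_fun Omega u' -> measurable_fun Omega g' ->
    measurable_fun Omega (f u' g').
  by move=> mu' mg'; apply/measurable_EFinP; exact: measurable_energy_density.
rewrite /energy -(ge0_integralZl_EFin _ mO (fun x _ => f0 u1 g1 x) (mf _ _ mu1 mg1) (ltW th0)).
rewrite -(ge0_integralZl_EFin _ mO (fun x _ => f0 u2 g2 x) (mf _ _ mu2 mg2) (ltW C0)).
have mZ k u' g' : measurable_fun Omega u' -> measurable_fun Omega g' ->
    measurable_fun Omega (fun x => k%:E * f u' g' x)%E.
  by move=> mu' mg'; apply: emeasurable_funM => //; exact: mf.
have Z0 k u' g' x : 0 < k -> (0 <= k%:E * f u' g' x)%E.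
  by move=> k0; rewrite mule_ge0// lee_fin ltW.
rewrite -ge0_integralD//; try by move=> x _; exact: Z0.
  2,3: exact: mZ.
apply: ge0_le_integral => //.
- by move=> x _; exact: (f0 u g).
- exact: (mf u g).
- by apply: emeasurable_funD; exact: mZ.
move=> x _; rewrite /f -!EFinM -EFinD lee_fin !mulrDr addrACA.
apply: lerD; apply: (le_trans _ (sC _ _ _ _)) => //; rewrite ?enorm_ge0//.
  by apply: ge0_ler_powR; rewrite ?nnegrE ?addr_ge0 ?enorm_ge0 ?(ltW p0).
by apply: ge0_ler_powR; rewrite ?nnegrE ?addr_ge0 ?(ltW p0).
Qed.

Lemma measurable_esphere rho : measurable (esphere N rho : set 'rV[R]_N).
Proof.
rewrite -[X in measurable X]setTI (_ : esphere N rho = @enorm R N @^-1` [set rho])//.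
exact: (@measurable_enorm R N).
Qed.

Lemma boundary_energy_split p theta C rho u u1 u2 :
  0 < p -> 0 < theta -> split_cst p theta C ->
  measurable_fun (esphere N rho) u ->
  measurable_fun (esphere N rho) u1 -> measurable_fun (esphere N rho) u2 ->
  (forall x, `|u x| <= `|u1 x| + `|u2 x|) ->
  (boundary_energy p rho u <=
   theta%:E * boundary_energy p rho u1 + C%:E * boundary_energy p rho u2)%E.
Proof.
move=> p0 th0 [C0 sC] mu mu1 mu2 uu; have mO := measurable_esphere rho.
pose f (u : 'rV[R]_N -> R) x := (`|u x| `^ p)%:E.
have f0 u' x : (0 <= f u' x)%E by rewrite lee_fin powR_ge0.
have mf u' : measurable_fun (esphere N rho) u' ->
    measurable_fun (esphere N rho) (f u').
  move=> mu'; apply/measurable_EFinP.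
  by apply: measurableT_comp (measurable_powR _) _; exact: measurableT_comp.
rewrite /boundary_energy -(ge0_integralZl_EFin _ mO (fun x _ => f0 u1 x) (mf _ mu1) (ltW th0)).
rewrite -(ge0_integralZl_EFin _ mO (fun x _ => f0 u2 x) (mf _ mu2) (ltW C0)).
have mZ k u' : measurable_fun (esphere N rho) u' ->
    measurable_fun (esphere N rho) (fun x => k%:E * f u' x)%E.
  by move=> mu'; apply: emeasurable_funM => //; exact: mf.
have Z0 k u' x : 0 < k -> (0 <= k%:E * f u' x)%E.
  by move=> k0; rewrite mule_ge0// lee_fin ltW.
rewrite -ge0_integralD//; try by move=> x _; exact: Z0.
  2,3: exact: mZ.
apply: ge0_le_integral => //.
- exact: mf.
- by apply: emeasurable_funD; exact: mZ.
move=> x _; rewrite /f -!EFinM -EFinD lee_fin.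
apply: (le_trans _ (sC _ _ _ _)) => //.
by apply: ge0_ler_powR; rewrite ?nnegrE ?addr_ge0 ?(ltW p0).
Qed.

Lemma sobolev_dist_lt p rho (w : sobolev p (eball N rho)) phi e :
  0 < p -> 0 < e -> (sobolev_dist w phi < e%:E)%E ->
  (energy p (eball N rho) (fun x => w x - phi x)%R
     (fun x => sob_grad w x - grad phi x)%R < (e `^ p)%:E)%E.
Proof.
move=> p0 e0; rewrite /sobolev_dist /sobolev_norm ltNge => h; rewrite ltNge.
apply: contra h => h.
have -> : e%:E = (((e `^ p)%:E) `^ p^-1)%E :> \bar R.
  by rewrite poweR_EFin -powRrM mulfV ?gt_eqF// powRr1// ltW.
apply: gt0_ler_poweR => //; rewrite ?in_itv/= ?leey ?andbT ?invr_ge0 ?(ltW p0)//.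
  by rewrite lee_fin powR_ge0.
exact: energy_ge0.
Qed.

Lemma measurable_rVB (D : set 'rV[R]_N) g g' : measurable D ->
  measurable_fun D g -> measurable_fun D g' -> measurable_fun D (fun x => g x - g' x).
Proof.
move=> mD mg mg'; apply/(measurable_restrictT _ mD); apply: measurable_fun_rVP => i.
have -> : (fun t => ((fun x => g x - g' x) \_ D) t ord0 i) =
    (fun x => g x ord0 i - g' x ord0 i) \_ D.
  by apply/funext => x; rewrite !patchE; case: ifP => _; rewrite !mxE.
apply/(measurable_restrictT _ mD); have mc := @measurable_rV_coor R N i.
by apply: measurable_funB; [exact: (measurableT_comp mc mg)|exact: (measurableT_comp mc mg')].
Qed.

(** The approximation [phi1] vanishes on the hole, so [HL] applies to it; [phi2] is close to [v] on
    the sphere. Both are close to [w] in the ball, so [trace_smooth] applied to [phi1 - phi2] shows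
    that [phi1] is close to [v] on the sphere as well. Letting [theta] tend to 1 recovers the
    constant [L]. *)
Lemma trace_closure p r rho (L : R) (w : sobolev p (eball N rho)) v :
  1 < p -> 0 < rho -> 0 <= L ->
  (forall phi, smooth_vanishing_on (eball N r) phi ->
     (boundary_energy p rho phi <=
      L%:E * energy p (eball N rho) phi (grad phi))%E) ->
  W1p_hole (eball N r) w -> is_trace w v ->
  (boundary_energy p rho v <= L%:E * energy p (eball N rho) w (sob_grad w))%E.
Proof.
move=> p1 rho0 L0 HL hw [mv tw].
have p0 : 0 < p by exact: lt_trans p1.
have mB := @measurable_eball R N rho.
set B := eball N rho in mB hw tw HL *.
pose K := trace_cst p + N%:R / rho.
have K0 : 0 < K by rewrite addr_gt0 ?trace_cst_gt0// divr_gt0.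
have mw := measurable_sob_fun w; have mgw := measurable_sob_grad w.
have Efin : energy p B w (sob_grad w) \is a fin_num.
  by rewrite ge0_fin_numE ?energy_ge0//; exact: sob_energy_lty.
pose E := fine (energy p B w (sob_grad w)).
have E0 : 0 <= E by rewrite fine_ge0// energy_ge0.
rewrite -(fineK Efin) -/E.
have [C1 C10 C1P] := powR_add_split p0 (ltr1n R 2).
have E2 : (0%:E <= 2%:E :> \bar R)%E by rewrite lee_fin; exact: ler0n.
have E3 : (0%:E <= C1%:E)%E by rewrite lee_fin; exact: ltW.
have main theta : 1 < theta ->
    (boundary_energy p rho v <= (theta * (L * (theta * E)))%:E)%E.
  move=> th1; have th0 : 0 < theta := lt_trans ltr01 th1.
  have [C C0 CP] := powR_add_split p0 th1.
  have EC : (0%:E <= C%:E)%E by rewrite lee_fin; exact: ltW.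
  (* The total coefficient of the error [e1] in the final estimate, so that [e1 = d / M] costs
     exactly [d]. *)
  pose M := theta * L * C + C * (2 * K * (2 + C1) + C1).
  have M0 : 0 < M.
    rewrite ltr_wpDl ?mulr_ge0 ?(ltW th0) ?(ltW C0)//.
    by rewrite mulr_gt0// addr_gt0// !mulr_gt0// addr_gt0.
  apply/lee_addgt0Pr => d d0.
  pose e1 := d / M; have e10 : 0 < e1 by rewrite divr_gt0.
  (* The ball error is given as a norm and used as a [p]-th power, the sphere error is already a
     [p]-th power: both [e^p <= e1] and [e <= e1] are required. *)
  pose e := Num.min e1 (e1 `^ p^-1).
  have e0 : 0 < e by rewrite lt_min e10 powR_gt0.
  have ee1 : e <= e1 by rewrite ge_min lexx.
  have epe1 : e `^ p <= e1.
    rewrite -[leRHS](powRr1 (ltW e10)) -(mulVf (lt0r_neq0 p0)) powRrM.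
    by apply: ge0_ler_powR; rewrite ?nnegrE ?powR_ge0 ?(ltW p0) ?(ltW e0)// ge_min lexx orbT.
  have [phi1 [sp1 v1] d1] := hw e e0.
  have [phi2 [sp2 d2 b2]] := tw e e0.
  have {}d1 := lt_le_trans (sobolev_dist_lt p0 e0 d1) (_ : (_ <= e1%:E)%E).
  have {}d1 := d1 epe1.
  have {}d2 := lt_le_trans (sobolev_dist_lt p0 e0 d2) (_ : (_ <= e1%:E)%E).
  have {}d2 := d2 epe1.
  have {}b2 : (boundary_energy p rho (fun x => (phi2 x - v x)%R) <= e1%:E)%E.
    by rewrite (le_trans (ltW b2))// lee_fin.
  have mp1 D := @measurable_funTS _ _ _ _ D _ (measurable_smooth sp1).
  have mp2 D := @measurable_funTS _ _ _ _ D _ (measurable_smooth sp2).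
  have mg1 D := @measurable_funTS _ _ _ _ D _ (measurable_grad sp1).
  have mg2 D := @measurable_funTS _ _ _ _ D _ (measurable_grad sp2).
  have sp12 := smoothB sp1 sp2.
  have mBr g g' : measurable_fun B g -> measurable_fun B g' ->
      measurable_fun B (fun x => g x - g' x : 'rV[R]_N).
    exact: measurable_rVB.
  have s1 : (boundary_energy p rho v <= theta%:E * boundary_energy p rho phi1 +
      C%:E * boundary_energy p rho (fun x => phi1 x - v x)%R)%E.
    apply: boundary_energy_split => //; first exact: measurable_funB.
    by move=> x; rewrite -{1}(subKr (phi1 x) (v x)) ler_normB.
  have s2 : (boundary_energy p rho (fun x => phi1 x - v x)%R <=
      2%:E * boundary_energy p rho (fun x => phi1 x - phi2 x)%R +
      C1%:E * boundary_energy p rho (fun x => phi2 x - v x)%R)%E.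
    apply: boundary_energy_split => //; try exact: measurable_funB.
    by move=> x; rewrite -{1}(subrK (phi2 x) (phi1 x)) -addrA ler_normD.
  have s3 := trace_smooth p1 rho0 sp12; rewrite -/K -/B in s3.
  have s4 : (energy p B (fun x => phi1 x - phi2 x)%R (grad (fun x => phi1 x - phi2 x)%R) <=
      2%:E * e1%:E + C1%:E * e1%:E)%E.
    refine (@le_trans _ _ _ _ _ (_ : (_ <= 2%:E * energy p B (fun x => w x - phi1 x)%R
       (fun x => sob_grad w x - grad phi1 x)%R + C1%:E * energy p B (fun x => w x - phi2 x)%R
       (fun x => sob_grad w x - grad phi2 x)%R)%E) _).
      apply: energy_split => //; try exact: measurable_funB; try exact: mBr.
      - exact: measurable_funTS (measurable_grad sp12).
      - move=> x; rewrite (_ : phi1 x - phi2 x = (w x - phi2 x) - (w x - phi1 x)).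
          by rewrite [leRHS]addrC ler_normB.
        by ring.
      - move=> x; rewrite gradB// (_ : grad phi1 x - grad phi2 x =
          (sob_grad w x - grad phi2 x) - (sob_grad w x - grad phi1 x)).
          by rewrite [leRHS]addrC (le_trans (enormD _ _))// enormN.
        by rewrite opprB [RHS]addrC [RHS]addrA subrK.
    exact: (leeD (lee_wpmul2l E2 (ltW d1)) (lee_wpmul2l E3 (ltW d2))).
  have s5 : (energy p B phi1 (grad phi1) <= theta%:E * E%:E + C%:E * e1%:E)%E.
    refine (@le_trans _ _ _ _ _ (_ : (_ <= theta%:E * energy p B w (sob_grad w) +
       C%:E * energy p B (fun x => w x - phi1 x)%R
       (fun x => sob_grad w x - grad phi1 x)%R)%E) _).
      apply: energy_split => //; try exact: measurable_funB; try exact: mBr.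
      - by move=> x; rewrite -{1}(subKr (w x) (phi1 x)) ler_normB.
      - move=> x; rewrite -{1}(subKr (sob_grad w x) (grad phi1 x)).
        by rewrite (le_trans (enormD _ _))// enormN.
    rewrite -(fineK Efin) -/E; apply: leeD => //.
    exact: (lee_wpmul2l EC (ltW d1)).
  have t6 : (boundary_energy p rho phi1 <= (L * (theta * E + C * e1))%:E)%E.
    by rewrite (le_trans (HL phi1 (conj sp1 v1)))// EFinM lee_wpmul2l ?lee_fin.
  have t3 : (boundary_energy p rho (fun x => phi1 x - phi2 x)%R <=
      (K * (2 * e1 + C1 * e1))%:E)%E.
    by rewrite (le_trans s3)// EFinM lee_wpmul2l ?lee_fin// ltW.
  have t2 : (boundary_energy p rho (fun x => phi1 x - v x)%R <=
      (2 * (K * (2 * e1 + C1 * e1)) + C1 * e1)%:E)%E.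
    by rewrite (le_trans s2)// [leRHS]EFinD leeD// [leRHS]EFinM lee_wpmul2l ?lee_fin// ltW.
  apply: (le_trans s1).
  apply: (@le_trans _ _ ((theta * (L * (theta * E + C * e1)) +
      C * (2 * (K * (2 * e1 + C1 * e1)) + C1 * e1))%:E)).
    by rewrite EFinD leeD// EFinM lee_wpmul2l ?lee_fin// ltW.
  rewrite lee_fin le_eqVlt; apply/orP; left; apply/eqP.
  have -> : d = e1 * M by rewrite divfK// gt_eqF.
  by rewrite /M; ring.
apply/lee_addgt0Pr => d d0.
pose F := L * E; have F0 : 0 <= F by exact: mulr_ge0.
(* Then [theta^2 F = F + d F / (F + 1) <= F + d]; the added 1 keeps the denominator positive when
   [F = 0]. *)
pose theta := Num.sqrt (1 + d / (F + 1)).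
have F1 : 0 < F + 1 by rewrite ltr_wpDl.
have q0 : 0 < d / (F + 1) by rewrite divr_gt0.
have th1 : 1 < theta.
  by rewrite -[X in X < _]sqrtr1 /theta ltr_sqrt ?ltrDl// addr_gt0.
apply: (le_trans (main theta th1)).
rewrite -!EFinM -EFinD lee_fin.
rewrite (_ : theta * _ = theta ^+ 2 * F); last by rewrite /F; ring.
rewrite sqr_sqrtr; last by rewrite addr_ge0// divr_ge0// ltW.
rewrite mulrDl mul1r -/F lerD2l mulrAC ler_pdivrMr//.
by rewrite ler_wpM2l ?(ltW d0)// lerDl.
Qed.

End closure.

Section lower_bound.
Context (R : realType) (n : nat).
Local Notation N := n.+1.
Implicit Types (p r rho : R).

Lemma smooth_cst0 : smooth (fun _ : 'rV[R]_N => 0 : R).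
Proof.
move=> s; have -> : foldr (@partial R N) (fun=> 0) s = (fun=> 0).
  elim: s => //= i s ->; apply/funext => x; rewrite /partial.
  exact: derive_cst.
by split => [x|i x]; [exact: cst_continuous|exact: derivable_cst].
Qed.

Lemma grad_cst0 (x : 'rV[R]_N) : grad (fun=> 0 : R) x = 0.
Proof. by apply/rowP => i; rewrite !mxE /partial; exact: derive_cst. Qed.

(** With zero energy, [w] would be at distance 0 from the zero function, which is a test function
    with empty support. *)
Lemma energy_gt0 p rho (w : sobolev p (eball N rho)) : 1 < p -> ~ W1p_0 w ->
  (0 < energy p (eball N rho) w (sob_grad w))%E.
Proof.
move=> p1 nw; rewrite lt_neqAle energy_ge0 andbT eq_sym; apply/eqP => E0.
apply: nw => e e0; exists (fun=> 0).
  by split; [exact: smooth_cst0|exists set0; split => //; exact: compact0].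
rewrite /sobolev_dist /sobolev_norm.
have -> : (fun x => w x - 0) = w by apply/funext => x; rewrite subr0.
have -> : (fun x => sob_grad w x - grad (fun=> 0) x) = sob_grad w.
  by apply/funext => x; rewrite grad_cst0 subr0.
by rewrite E0 poweR0r ?lte_fin// invr_eq0 gt_eqF// (lt_trans ltr01).
Qed.

Lemma steklov_ge p r rho (L : R) : 1 < p -> 0 < rho -> 0 < L ->
  (forall phi, smooth_vanishing_on (eball N r) phi ->
     (boundary_energy p rho phi <=
      L%:E * energy p (eball N rho) phi (grad phi))%E) ->
  ((L^-1)%:E <= steklov N p r rho)%E.
Proof.
move=> p1 rho0 L0 HL; apply: le_ereal_inf_tmp => _ [w [v [hw w0 tw ->]]].
have := trace_closure p1 rho0 (ltW L0) HL hw tw.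
have := energy_gt0 p1 w0; have := sob_energy_lty w.
have := boundary_energy_ge0 p rho v.
move: (energy _ _ _ _) (boundary_energy _ _ _) => [E| |] [b| |]//.
rewrite lee_fin lte_fin => b0 _ E0; rewrite -EFinM lee_fin => bE.
(* If the boundary energy is 0, the quotient is [+oo] because the energy is positive. *)
rewrite inver; case: eqVneq => [_|bn0]; first by rewrite gt0_muley ?leey// lte_fin.
have {bn0}b0 : 0 < b by rewrite lt_neqAle eq_sym bn0.
by rewrite -EFinM lee_fin ler_pdivlMr// mulrC ler_pdivrMr// mulrC.
Qed.

End lower_bound.

(** * Smooth functions as Sobolev functions *)

Section integration_by_parts.
Context (R : realType) (n : nat).
Local Notation N := n.+1.
Local Notation leb := (lebesgue_rV R N).
Implicit Types (f phi psi : 'rV[R]_N -> R) (x : 'rV[R]_N) (K : set 'rV[R]_N).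

Lemma support_bound f K : compact K -> continuous f -> (forall x, ~ K x -> f x = 0) ->
  exists2 C : R, 0 < C & forall x, `|f x| <= C.
Proof.
move=> cK cf f0.
have /compact_bounded : compact (f @` K).
  by apply: continuous_compact => //; exact: continuous_subspaceT.
move=> /ex_strict_bound_gt0[M M0 hM]; exists M => // x.
have [xK|xK] := pselect (K x).
  by apply/ltW; apply: hM => /=; exists x.
by rewrite f0// normr0 ltW.
Qed.

Lemma compact_box K : compact K -> exists2 M : R, 0 < M & K `<=` @rV_box R N M.
Proof.
move=> /compact_bounded /ex_strict_bound_gt0[M M0 hM]; exists M => // x Kx i.
by rewrite (le_trans (coor_le_norm x i))// ltW// hM.
Qed.

Lemma integrable_box (C M : R) : 0 <= M ->
  leb.-integrable setT (fun x => (C * \1_(rV_box M) x)%:E).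
Proof.
move=> M0; have mB := @measurable_rV_box R N M.
have -> : (fun x => (C * \1_(rV_box M) x)%:E) = (fun x => C%:E * (\1_(rV_box M) x)%:E)%E.
  by apply/funext => x; rewrite EFinM.
apply: integrableZl => //; apply/integrableP; split.
  by apply/measurable_EFinP; exact: measurable_indic.
under eq_integral do rewrite gee0_abs ?lee_fin//.
by rewrite integral_indic// setIT lebesgue_rV_box// ltry.
Qed.

Lemma integrable_supported f K : compact K -> continuous f ->
  (forall x, ~ K x -> f x = 0) -> leb.-integrable setT (EFin \o f).
Proof.
move=> cK cf f0; have [C C0 fC] := support_bound cK cf f0.
have [M M0 KM] := compact_box cK.
have mf := continuous_measurable_rV cf.
apply: (@le_integrable _ _ _ _ _ measurableT _ (fun x => (C * \1_(rV_box M) x)%:E)).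
- exact/measurable_EFinP.
- move=> x _; rewrite /= lee_fin [leRHS]ger0_norm ?mulr_ge0 ?(ltW C0)// indicE.
  have [xM|xM] := boolP (x \in _); first by rewrite mulr1.
  rewrite mulr0 f0 ?normr0//.
  by move=> /KM /mem_set; apply/negP.
by apply: integrable_box; exact: ltW.
Qed.

Lemma integral_translate f (b : 'rV[R]_N) : measurable_fun setT f ->
  (\int[leb]_x (f (x + b)%R)%:E = \int[leb]_x (f x)%:E)%E.
Proof.
move=> mf; rewrite integralE [RHS]integralE.
have T (g : 'rV[R]_N -> \bar R) : measurable_fun setT g -> (forall x, 0 <= g x)%E ->
    (\int[leb]_x g (x + b)%R = \int[leb]_x g x)%E.
  move=> mg g0; have := @ge0_integral_rV_affine R N 1 b g ltr01 mg g0.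
  rewrite expr1n invr1 mul1e => <-.
  by apply: eq_integral => x _; rewrite scale1r.
have mfE : measurable_fun setT (fun x => (f x)%:E) by exact/measurable_EFinP.
rewrite -(T _ (measurable_funepos mfE) (funepos_ge0 _))
  -(T _ (measurable_funeneg mfE) (funeneg_ge0 _)).
by congr (_ - _)%E; apply: eq_integral => x _; rewrite ?funeposE ?funenegE.
Qed.

(** By translation invariance every difference quotient of [f] has integral 0; the quotients
    converge to the partial derivative, dominated through [MVT_line] by a bounded function with
    bounded support. *)
Lemma integral_partial0 f K (i : 'I_N) : compact K -> continuous f ->
  (forall x, derivable f x (delta_mx ord0 i)) -> continuous (partial i f) ->
  (forall x, ~ K x -> f x = 0) -> (forall x, ~ K x -> partial i f x = 0) ->
  (\int[leb]_x (partial i f x)%:E = 0)%E.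
Proof.
move=> cK cf df cdf f0 df0.
set v : 'rV[R]_N := delta_mx ord0 i.
have [C C0 fC] := support_bound cK cdf df0.
have [M M0 KM] := compact_box cK.
pose h (k : nat) : R := k.+1%:R^-1.
have h0 k : 0 < h k by rewrite invr_gt0.
have h1 k : h k <= 1 by rewrite invf_le1// ler1n.
pose q (k : nat) x : R := (h k)^-1 * (f (h k *: v + x) - f x).
have intf := integrable_supported cK cf f0.
have mf := continuous_measurable_rV cf.
have mfs b : measurable_fun setT (fun x : 'rV[R]_N => f (x + b)).
  have := @measurable_rV_affine R N 1 b => maff.
  have := measurableT_comp mf maff; congr (measurable_fun setT _).
  by apply/funext => x /=; rewrite scale1r.
have mq k : measurable_fun setT (q k).
  apply: measurable_funM => //; apply: measurable_funB => //.
  by under eq_fun do rewrite addrC; exact: mfs.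
have intfs b : leb.-integrable setT (fun x => (f (x + b))%:E).
  apply/integrableP; split; first exact/measurable_EFinP.
  have /integrableP[_] := intf; congr (_ < _)%E; apply: esym.
  apply: (@integral_translate (fun x => `|f x|) b); exact: measurableT_comp.
have intq k : (\int[leb]_x (q k x)%:E = 0)%E.
  rewrite (_ : (fun x => _) = (fun x => ((h k)^-1)%:E * ((f (x + h k *: v))%:E - (f x)%:E))%E).
    have ifin : (\int[leb]_x (f x)%:E)%E \is a fin_num by exact: integrable_fin_num.
    rewrite integralZl//; last exact: integrableB.
    by rewrite integralB// integral_translate// subee// mule0.
  by apply/funext => x; rewrite -EFinB -EFinM /q [_ + x]addrC.
(* The steps [h k] are at most 1, so the quotients vanish outside the cube enlarged by 1. *)
have qD k x : `|q k x| <= C * \1_(rV_box (M + 1)) x.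
  have [c ch qE] := MVT_line x (h k) df.
  have {}qE : q k x = partial i f (c *: v + x).
    by rewrite /q qE mulKf// gt_eqF.
  rewrite indicE; have [xM|xM] := boolP (x \in _); first by rewrite mulr1 qE.
  rewrite mulr0 qE df0 ?normr0// => /KM xcM; move: xM => /negP; apply.
  apply/mem_set => j; rewrite -(addKr (c *: v ord0 j) (x ord0 j)).
  have := xcM j; rewrite !mxE => xcMj.
  rewrite addrC (le_trans (ler_normD _ _))// lerD// normrN normrM.
  apply: (@le_trans _ _ (1 * 1)); last by rewrite mulr1.
  apply: ler_pM => //; first by rewrite (le_trans ch)// gtr0_norm//; exact: h1.
  by case: (_ && _); rewrite ?normr1 ?normr0.
have h_cvg : h k @[k --> \oo] --> (0 : R)^'.
  move=> A A0.
  have Ah : \forall k \near \oo, h k != 0 -> A (h k) by exact: (@cvg_harmonic R _ A0).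
  change (\forall k \near \oo, A (h k)).
  by apply: filterS Ah => k; apply; rewrite gt_eqF.
have qcvg x : q k x @[k --> \oo] --> partial i f x.
  have dfx : h^-1 *: ((f \o shift x) (h *: v) - f x) @[h --> (0 : R)^'] -->
      partial i f x by exact: df.
  exact: (@cvg_comp _ _ _ h _ _ _ _ h_cvg dfx).
have [//| | | | |_ _] := @dominated_convergence _ _ _ leb setT measurableT
  (fun k x => (q k x)%:E) (fun x => (partial i f x)%:E)
  (fun x => (C * \1_(rV_box (M + 1)) x)%:E).
- by move=> k; apply/measurable_EFinP.
- by apply/measurable_EFinP; exact: continuous_measurable_rV.
- apply: aeW => x _; apply: cvg_EFin; first exact: nearW.
  exact: qcvg.
- by apply: integrable_box; rewrite addr_ge0// ltW.
- by apply: aeW => x k _; rewrite abse_EFin lee_fin.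
under eq_fun do rewrite intq; move=> c0.
exact: (cvg_unique _ c0 (cvg_cst _)).
Qed.

(** The partial derivative of [phi psi] has integral 0 over the whole space. Both terms of the
    product rule are supported in [K], inside [Omega], so the integrals over [Omega] are the
    same. *)
Lemma smooth_weak_grad phi psi Omega (i : 'I_N) : measurable Omega ->
  smooth phi -> test_functions Omega psi ->
  \int[leb]_(x in Omega) (phi x * partial i psi x) =
  - \int[leb]_(x in Omega) (grad phi x ord0 i * psi x).
Proof.
move=> mO sp [sq [K [cK KO psi0]]].
have dpsi0 x : ~ K x -> partial i psi x = 0.
  move=> nK; rewrite /partial (@near_eq_derive _ _ _ _ (fun=> 0)).
    exact: derive_cst.
  have oK : open (~` K) by apply: closed_openC; exact: compact_closed.
  by apply: filterS (open_nbhs_nbhs (conj oK nK)) => y /psi0.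
have cp := smooth_continuous sp; have cq := smooth_continuous sq.
have cdp : continuous (partial i phi) by exact/smooth_continuous/smooth_partial.
have cdq : continuous (partial i psi) by exact/smooth_continuous/smooth_partial.
pose f1 x := phi x * partial i psi x; pose f2 x := partial i phi x * psi x.
have cf1 : continuous f1 by move=> x; exact: (cvgM (cp x) (cdq x)).
have cf2 : continuous f2 by move=> x; exact: (cvgM (cdp x) (cq x)).
have f10 x : ~ K x -> f1 x = 0 by move=> /dpsi0; rewrite /f1 => ->; rewrite mulr0.
have f20 x : ~ K x -> f2 x = 0 by move=> /psi0; rewrite /f2 => ->; rewrite mulr0.
have if1 := integrable_supported cK cf1 f10.
have if2 := integrable_supported cK cf2 f20.
have dE x : is_derive x (delta_mx ord0 i) (fun y => phi y * psi y) (f2 x + f1 x).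
  by apply: is_derive_mul; apply/derivableP; exact: smooth_derivable.
have pE : partial i (fun y => phi y * psi y) = (fun x => f2 x + f1 x).
  by apply/funext => x; have [_] := dE x.
have I0 : (\int[leb]_x (f2 x + f1 x)%:E = 0)%E.
  rewrite (_ : (fun x => _) =
      (fun x => (partial i (fun y => phi y * psi y) x)%:E)); last by rewrite pE.
  apply: (integral_partial0 cK).
  - by move=> x; exact: (cvgM (cp x) (cq x)).
  - by move=> x; case: (dE x).
  - by rewrite pE => x; exact: (cvgD (cf2 x) (cf1 x)).
  - by move=> x /psi0 ->; rewrite mulr0.
  - by move=> x nK; rewrite pE f10// f20// addr0.
have R1 f : (forall x, ~ K x -> f x = 0) ->
    (\int[leb]_(x in Omega) (f x)%:E = \int[leb]_x (f x)%:E)%E.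
  move=> f0; rewrite integral_mkcond; apply: eq_integral => x _.
  rewrite patchE; case: ifPn => // xO; rewrite f0// => /KO /mem_set; exact/negP.
have E1 : (\int[leb]_(x in Omega) (f1 x)%:E = - \int[leb]_(x in Omega) (f2 x)%:E)%E.
  rewrite !R1//; move: I0; under eq_integral do rewrite EFinD.
  rewrite integralD//.
  have : (\int[leb]_x (f1 x)%:E)%E \is a fin_num by exact: integrable_fin_num.
  have : (\int[leb]_x (f2 x)%:E)%E \is a fin_num by exact: integrable_fin_num.
  case: (\int[leb]_x (f1 x)%:E)%E => // a; case: (\int[leb]_x (f2 x)%:E)%E => // b _ _.
  by rewrite -EFinD -EFinN => -[ab]; congr EFin; apply/eqP; rewrite -subr_eq0 opprK addrC ab.
rewrite /Rintegral -[LHS]/(fine (\int[leb]_(x in Omega) (f1 x)%:E)%E) E1 fineN.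
by congr (- fine _); apply: eq_integral => x _; rewrite mxE.
Qed.

End integration_by_parts.

(** * Smooth functions as competitors for the Steklov constant *)

Section upper_bound.
Context (R : realType) (n : nat).
Local Notation N := n.+1.
Implicit Types (p r rho : R) (phi : 'rV[R]_N -> R).

Lemma energy0 p (Omega : set 'rV[R]_N) : p != 0 ->
  energy p Omega (fun=> 0) (fun=> 0) = 0%E.
Proof.
by move=> p0; apply: integral0_eq => x _; rewrite enorm0 normr0 powR0// addr0.
Qed.

(** [phi] is its own trace. It is outside [W1p_0]: for a test function [psi] close to [phi], the
    difference equals [phi] on the sphere, and [trace_smooth] would make the boundary energy
    arbitrarily small. *)
Lemma steklov_le p r rho phi : 1 < p -> 0 < rho ->
  smooth_vanishing_on (eball N r) phi ->
  (energy p (eball N rho) phi (grad phi) < +oo)%E ->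
  (0 < boundary_energy p rho phi)%E ->
  (steklov N p r rho <=
   energy p (eball N rho) phi (grad phi) / boundary_energy p rho phi)%E.
Proof.
move=> p1 rho0 [sp v0] Elt b0.
have p0 : 0 < p by exact: lt_trans p1.
have pi0 : p^-1 != 0 by rewrite invr_eq0 gt_eqF.
pose w : sobolev p (eball N rho) := @Sobolev R N p (eball N rho) phi (grad phi)
  (measurable_funTS (measurable_smooth sp)) (measurable_funTS (measurable_grad sp)) Elt
  (fun psi tpsi i => smooth_weak_grad i (@measurable_eball R N rho) sp tpsi).
have d0 : sobolev_dist w phi = 0%E.
  rewrite /sobolev_dist /sobolev_norm.
  have -> : (fun x => w x - phi x) = (fun=> 0) by apply/funext => x; rewrite subrr.
  have -> : (fun x => sob_grad w x - grad phi x) = (fun=> 0).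
    by apply/funext => x; rewrite subrr.
  by rewrite energy0 ?gt_eqF// poweR0r.
apply: ereal_inf_lbound; exists w, phi; split => //.
- by move=> e e0; exists phi => //; rewrite d0 lte_fin.
- move=> w0.
  have K0 : 0 < trace_cst p + N%:R / rho :> R.
    by rewrite addr_gt0 ?trace_cst_gt0// divr_gt0.
  have bl e : 0 < e ->
      (boundary_energy p rho phi <= ((trace_cst p + N%:R / rho) * e `^ p)%:E)%E.
    move=> e0; have [psi [sq [K [_ KO psi0]]] dpsi] := w0 e e0.
    have := sobolev_dist_lt p0 e0 dpsi => /ltW E1.
    have -> : boundary_energy p rho phi = boundary_energy p rho (fun x => phi x - psi x).
      apply: eq_integral => x; rewrite inE/= => xs; rewrite psi0 ?subr0//.
      by move=> /KO /=; rewrite /eball/= xs ltxx.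
    apply: (le_trans (trace_smooth p1 rho0 (smoothB sp sq))).
    rewrite EFinM; apply: lee_wpmul2l; first by rewrite lee_fin (ltW K0).
    have -> : grad (fun x => phi x - psi x) = (fun x => grad phi x - grad psi x).
      by apply/funext => x; exact: gradB.
    exact: E1.
  have := bl 1 ltr01; have := boundary_energy_ge0 p rho phi.
  move: (boundary_energy p rho phi) b0 bl => [b| |]//; rewrite lte_fin => b0 bl _ _.
  (* Chosen so that the trace bound at distance [e] equals [b / 2], contradicting [b > 0]. *)
  pose e := (b / 2 / (trace_cst p + N%:R / rho)) `^ p^-1.
  have e0 : 0 < e by rewrite powR_gt0// !divr_gt0.
  have := bl e e0; rewrite lee_fin /e -powRrM mulVf ?gt_eqF// powRr1.
    rewrite mulrCA mulfV ?gt_eqF// mulr1 leNgt => /negP; apply.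
    by rewrite gtr_pMr// invf_lt1// ltr1n.
  by rewrite !divr_ge0// ltW.
split; first exact: measurable_funTS (measurable_smooth sp).
move=> e e0; exists phi; split => //; first by rewrite d0 lte_fin.
rewrite /boundary_energy integral0_eq ?lte_fin// => x _.
by rewrite subrr normr0 powR0// gt_eqF.
Qed.

End upper_bound.

(** * Test functions *)

Section flat_functions.
Context (R : realType).
Implicit Types (s : R) (j : nat).

(** The family is indexed by [j] because the derivative of [exp(-1/s)] brings in negative powers of
    [s]: each derivative combines the next two members. *)
Definition flat j s : R := if 0 < s then s ^- j * expR (- s^-1) else 0.

Lemma flat_le0 j s : s <= 0 -> flat j s = 0.
Proof. by rewrite /flat ltNge => ->. Qed.

Lemma flat_ge0 j s : 0 <= flat j s.
Proof.
rewrite /flat; case: ifP => // s0.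
by rewrite mulr_ge0// ?expR_ge0// invr_ge0 exprn_ge0// ltW.
Qed.

Lemma flatS j s : s * flat j.+1 s = flat j s.
Proof.
rewrite /flat; case: ifP => s0; last by rewrite mulr0.
by rewrite exprS invfM !mulrA mulfV ?mul1r// gt_eqF.
Qed.

(** With [u = 1/s], this is the exponential series bound [u^(j+1) <= (j+1)! exp u]. *)
Lemma flat_le_fact j s : flat j.+1 s <= j.+1`!%:R.
Proof.
rewrite /flat; case: ifPn => [s0|_]; last exact: ler0n.
have u0 : 0 < s^-1 by rewrite invr_gt0.
have := expR_ge1Dxn j (ltW u0) => h.
rewrite expRN ler_pdivrMr ?expR_gt0// mulrC -ler_pdivrMr ?ltr0n ?fact_gt0//.
by rewrite -exprVn (le_trans _ h)// lerDr.
Qed.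

Lemma flat0_le1 s : flat 0 s <= 1.
Proof.
rewrite /flat; case: ifPn => // s0; rewrite expr0 invr1 mul1r.
by rewrite expR_le1 oppr_le0 invr_ge0 ltW.
Qed.

(* The difference quotient at 0 is the next member of the family. *)
Lemma is_derive_flat j s :
  is_derive s 1 (flat j) (flat j.+2 s - j%:R * flat j.+1 s).
Proof.
have [s0|s0|->] := ltgtP s 0.
- rewrite !flat_le0 ?(ltW s0)// mulr0 subr0.
  apply: (@near_eq_is_derive R R R (fun=> 0 : R)).
  apply: filterS (lt_nbhsl s0) => t t0; by rewrite flat_le0// ltW.
- apply: (@near_eq_is_derive _ _ _ (fun s => s ^- j * expR (- s^-1))).
    by apply: filterS (lt_nbhsr s0) => t t0; rewrite /flat t0.
  have sn0 : s != 0 by rewrite gt_eqF.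
  apply: is_derive_eq.
    apply: is_derive_mul.
      by apply: is_derive_inv; [exact: expf_neq0|exact: is_derive_exprn].
    apply: (@is_derive_comp R R (fun s : R => - s^-1) expR).
    apply: (@is_deriveN R R R^o (fun s => s^-1)).
    exact: (@is_derive_inv R R (fun s => s) s 1 1).
  rewrite /flat s0; have : s ^+ j != 0 by exact: expf_neq0.
  case: j => [|j]; first by move=> _; rewrite /= !expr0; field.
  rewrite /= !exprS; move: (s ^+ j) (expR _) (j.+1%:R) => a b c.
  rewrite mulf_eq0 negb_or => /andP[_ a0]; field.
  by rewrite a0 sn0.
rewrite !flat_le0// mulr0 subr0.
have cvg : h^-1 *: ((flat j \o shift 0) (h *: (1 : R)) - flat j 0)
    @[h --> (0 : R)^'] --> (0 : R).
  apply/cvgrPdist_lt => e e0; near=> h.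
  have h0 : h != 0 by near: h; exact: nbhs_dnbhs_neq.
  rewrite /= addr0 [_ *: 1]mulr1 (flat_le0 j (lexx 0)) subr0 sub0r normrN.
  rewrite /GRing.scale/= -flatS mulKf// ger0_norm ?flat_ge0//.
  have [h_le0|h_gt0] := leP h 0; first by rewrite flat_le0.
  (* One more factor [h] is extracted from the flat function, and the remaining member is bounded by
     a factorial. *)
  rewrite -flatS; apply: (@le_lt_trans _ _ (h * j.+2`!%:R)).
    by apply: ler_wpM2l; [exact: ltW|exact: flat_le_fact].
  rewrite -ltr_pdivlMr ?ltr0n ?fact_gt0// -(gtr0_norm h_gt0).
  by near: h; apply: dnbhs0_lt; rewrite divr_gt0// ltr0n fact_gt0.
by split; [apply/cvg_ex; exists 0|exact: cvg_lim cvg].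
Unshelve. all: by end_near. Qed.

End flat_functions.

Section smooth_class.
Context (R : realType) (N : nat).
Implicit Types (f g : 'rV[R]_N -> R).

(** A class of formulas that contains the test functions and is closed under partial derivatives;
    smoothness of all orders then needs no explicit higher derivative. *)
Inductive smooth_expr : ('rV[R]_N -> R) -> Prop :=
| expr_cst c : smooth_expr (fun=> c)
| expr_coor i : smooth_expr (fun x => x ord0 i)
| expr_add f g : smooth_expr f -> smooth_expr g -> smooth_expr (fun x => f x + g x)
| expr_mul f g : smooth_expr f -> smooth_expr g -> smooth_expr (fun x => f x * g x)
| expr_flat j f : smooth_expr f -> smooth_expr (fun x => flat j (f x)).

Lemma expr_sum I (s : seq I) (F : I -> 'rV[R]_N -> R) :
  (forall i, smooth_expr (F i)) -> smooth_expr (fun x => \sum_(i <- s) F i x).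
Proof.
move=> sF; elim: s => [|i s IH].
  by under eq_fun do rewrite big_nil; exact: expr_cst.
by under eq_fun do rewrite big_cons; exact: expr_add.
Qed.

Lemma expr_exp f k : smooth_expr f -> smooth_expr (fun x => f x ^+ k).
Proof.
move=> sf; elim: k => [|k IH].
  by under eq_fun do rewrite expr0; exact: expr_cst.
by under eq_fun do rewrite exprS; exact: expr_mul.
Qed.

Lemma is_derive_coor i j (x : 'rV[R]_N) :
  is_derive x (delta_mx ord0 i) (fun y : 'rV[R]_N => y ord0 j) ((j == i)%:R : R).
Proof.
have -> : (j == i)%:R = (delta_mx ord0 i : 'rV[R]_N) ord0 j :> R by rewrite mxE.
apply/is_derive_dir.
have -> : (fun h : R => (h *: (delta_mx ord0 i : 'rV[R]_N) + x) ord0 j) =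
   (fun h : R => h * (delta_mx ord0 i : 'rV[R]_N) ord0 j + x ord0 j).
  by apply/funext => h; rewrite !mxE.
set d := (delta_mx _ _ : 'rV[R]_N) _ _.
have d1 : is_derive (0 : R) 1 (fun h : R => d * h) (d * 1).
  by apply: is_derive_scale; exact: is_derive_id.
have := is_derive_add d1 (@is_derive_const R R (x ord0 j) 0 1).
rewrite addr0 mulr1 (_ : (fun y => d * y + _) = (fun h => h * d + x ord0 j))//.
by apply/funext => h; rewrite mulrC.
Qed.

Lemma smooth_expr_partial f : smooth_expr f ->
  continuous f /\ forall i, exists2 g, smooth_expr g &
    forall x, is_derive x (delta_mx ord0 i) f (g x).
Proof.
elim=> [c|i|f1 f2 s1 [c1 d1] s2 [c2 d2]|f1 f2 s1 [c1 d1] s2 [c2 d2]|j f1 s1 [c1 d1]].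
- split; first exact: cst_continuous.
  by move=> i; exists (fun=> 0); [exact: expr_cst|move=> x; exact: is_derive_const].
- split; first exact: coord_continuous.
  move=> j; exists (fun=> (i == j)%:R); first exact: expr_cst.
  by move=> x; exact: is_derive_coor.
- split; first by move=> x; exact: (cvgD (c1 x) (c2 x)).
  move=> i; have [g1 sg1 dg1] := d1 i; have [g2 sg2 dg2] := d2 i.
  exists (fun x => g1 x + g2 x); first exact: expr_add.
  by move=> x; exact: is_derive_add.
- split; first by move=> x; exact: (cvgM (c1 x) (c2 x)).
  move=> i; have [g1 sg1 dg1] := d1 i; have [g2 sg2 dg2] := d2 i.
  exists (fun x => g1 x * f2 x + f1 x * g2 x).
    by apply: expr_add; exact: expr_mul.
  by move=> x; exact: is_derive_mul.
split.
  move=> x; apply: (@continuous_comp _ _ _ f1 (flat j)); first exact: c1.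
  exact: is_derive_continuous (is_derive_flat j (f1 x)).
move=> i; have [g1 sg1 dg1] := d1 i.
exists (fun x => (flat j.+2 (f1 x) + (- j%:R) * flat j.+1 (f1 x)) * g1 x).
  apply: expr_mul => //; apply: expr_add; first exact: expr_flat.
  by apply: expr_mul; [exact: expr_cst|exact: expr_flat].
by move=> x; rewrite mulNr; apply: is_derive_comp => //; exact: is_derive_flat.
Qed.

Lemma smooth_exprP f : smooth_expr f -> smooth f.
Proof.
move=> sf s.
suff /smooth_expr_partial[c d] : smooth_expr (foldr (@partial R N) f s).
  split => // i x; have [g _ dg] := d i; by case: (dg x).
elim: s => //= i s IH; have [_ /(_ i)[g sg dg]] := smooth_expr_partial IH.
by rewrite (_ : partial i _ = g)//; apply/funext => x; case: (dg x).
Qed.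

End smooth_class.

Section test_function.
Context (R : realType) (n : nat).
Local Notation N := n.+1.
Variables (r rho : R) (k : nat).
Hypotheses (r0 : 0 < r) (rrho : r < rho).
Implicit Types (x : 'rV[R]_N).

Let rho0 : 0 < rho. Proof. exact: lt_trans rrho. Qed.

(* The flat factor vanishes on the hole and tends to 1 on the sphere as [rho]
   grows; the power imitates the optimal profile exp((p - 1)^(-1/p) |x|) near
   the sphere. *)
Definition test_fun x : R :=
  flat 0 (\sum_(i < N) x ord0 i ^+ 2 + - r ^+ 2) *
  (rho ^- 2 * \sum_(i < N) x ord0 i ^+ 2) ^+ k.+1.

Lemma test_funE x :
  test_fun x = flat 0 (enorm x ^+ 2 - r ^+ 2) * ((enorm x / rho) ^+ 2) ^+ k.+1.
Proof. by rewrite /test_fun -sqr_enorm expr_div_n [_ / _ ^+ 2]mulrC. Qed.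

Lemma smooth_expr_sq : smooth_expr (fun x => \sum_(i < N) x ord0 i ^+ 2).
Proof. by apply: expr_sum => i; apply: expr_exp; exact: expr_coor. Qed.

Lemma smooth_test_fun : smooth test_fun.
Proof.
apply: smooth_exprP; apply: expr_mul.
  apply: expr_flat; apply: expr_add; [exact: smooth_expr_sq|exact: expr_cst].
apply: expr_exp; apply: expr_mul; [exact: expr_cst|exact: smooth_expr_sq].
Qed.

Lemma test_fun_vanish x : eball N r x -> test_fun x = 0.
Proof.
rewrite /eball/= => xr; rewrite test_funE flat_le0 ?mul0r// subr_le0.
by rewrite ler_pXn2r ?nnegrE ?enorm_ge0 ?(ltW r0)// ltW.
Qed.

Lemma is_derive_sq x i :
  is_derive x (delta_mx ord0 i) (fun y : 'rV[R]_N => \sum_(j < N) y ord0 j ^+ 2)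
    (2 * x ord0 i).
Proof.
have H (s : seq 'I_N) : is_derive x (delta_mx ord0 i)
    (fun y : 'rV[R]_N => \sum_(j <- s) y ord0 j ^+ 2)
    (\sum_(j <- s) 2%:R * x ord0 j * (j == i)%:R).
  elim: s => [|j s IH].
    by under eq_fun do rewrite big_nil; rewrite big_nil; exact: is_derive_const.
  under eq_fun do rewrite big_cons; rewrite big_cons; apply: is_derive_add => //.
  by apply: is_derive_exprn; exact: is_derive_coor.
have := H (index_enum 'I_N).
rewrite (bigD1 i)//= eqxx mulr1 big1 ?addr0// => j /negbTE ->.
by rewrite mulr0.
Qed.

(** Twice the derivative of the test function with respect to [|x|^2], that is, the scalar factor of
    its radial gradient. *)
Definition test_slope x : R :=
  let q := enorm x ^+ 2 in
  2 * (flat 2 (q - r ^+ 2) * ((enorm x / rho) ^+ 2) ^+ k.+1 +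
       flat 0 (q - r ^+ 2) * (k.+1%:R * ((enorm x / rho) ^+ 2) ^+ k * rho ^- 2)).

Lemma grad_test_fun x : grad test_fun x = test_slope x *: x.
Proof.
apply/rowP => i; rewrite !mxE /partial.
pose sq (y : 'rV[R]_N) := \sum_(j < N) y ord0 j ^+ 2.
have dq := is_derive_sq x i; rewrite -/(sq) in dq.
have d1 := is_derive_add dq (is_derive_const (- r ^+ 2) x (delta_mx ord0 i)).
have d2 := @is_derive_comp _ _ (fun y => sq y + - r ^+ 2) (flat 0) x _ _ _
  (is_derive_flat 0 (sq x + - r ^+ 2)) d1.
have d3 := is_derive_exprn k.+1 (is_derive_scale (rho ^- 2) dq).
have [_ ->] := is_derive_mul d2 d3.
have qE : (enorm x / rho) ^+ 2 = rho ^- 2 * sq x.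
  by rewrite expr_div_n sqr_enorm mulrC.
rewrite /= /test_slope qE sqr_enorm -/(sq x) mul0r subr0 addr0 exprS.
move: (flat 2 _) (flat 0 _) (rho ^- 2) (_ ^+ k) (k.+1%:R) => a b c d e.
ring.
Qed.

Lemma test_slope_ge0 x : 0 <= test_slope x.
Proof.
have q0 : 0 <= (enorm x / rho) ^+ 2 by exact: sqr_ge0.
apply: mulr_ge0 => //; apply: addr_ge0; apply: mulr_ge0; rewrite ?flat_ge0//.
  exact: exprn_ge0.
apply: mulr_ge0; last by rewrite invr_ge0 sqr_ge0.
by apply: mulr_ge0 => //; exact: exprn_ge0.
Qed.

(** Writing [|x|^2 = q + r^2], the derivative of the flat factor gives
    [2 (flat 1 q + r^2 flat 2 q) <= 2 + 4 r^2], a bound independent of [rho] and [k]; the power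
    gives [2 (k + 1)]. *)
Lemma enorm_grad_test_fun x : x != 0 ->
  enorm (grad test_fun x) <=
  ((2 * k.+1)%:R + (2 + 4 * r ^+ 2)) / rho * (enorm x / rho) ^+ (2 * k + 1).
Proof.
move=> x0; have ex := enorm_gt0 x0.
rewrite grad_test_fun enormZ ger0_norm ?test_slope_ge0// /test_slope.
set t := enorm x in ex *; set q := t ^+ 2 - r ^+ 2.
have b1 : flat 1 q <= 1 by exact: (flat_le_fact 0 q).
have b2 : flat 2 q <= 2 by exact: (flat_le_fact 1 q).
have b0 := flat0_le1 q.
rewrite [leLHS](_ : _ = ((2 * k.+1)%:R * flat 0 q + 2 * (flat 1 q + r ^+ 2 * flat 2 q)) / rho *
   (t / rho) ^+ (2 * k + 1)); last first.
  rewrite -(flatS 1 q) /q natrM exprD expr1 exprM (exprS _ k).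
  move: (flat 2 _) (flat 0 _) (((t / rho) ^+ 2) ^+ k) (k.+1%:R) => f2 f0 a c.
  by field; rewrite gt_eqF.
have c0 : 0 <= (t / rho) ^+ (2 * k + 1) by rewrite exprn_ge0// divr_ge0 ?ltW.
apply: ler_wpM2r => //; apply: ler_wpM2r; first by rewrite invr_ge0 ltW.
apply: lerD; first by rewrite ler_piMr.
have : flat 1 q + r ^+ 2 * flat 2 q <= 1 + r ^+ 2 * 2.
  by apply: lerD => //; rewrite ler_wpM2l// sqr_ge0.
lra.
Qed.

(** The exponent is lowered from [2k + 2] to [2k + 1], the one of the gradient bound, so that both
    parts of the energy are compared with the same power. *)
Lemma test_fun_bound x : enorm x < rho ->
  `|test_fun x| <= (enorm x / rho) ^+ (2 * k + 1).
Proof.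
move=> xr; rewrite test_funE -exprM.
have u0 : 0 <= enorm x / rho by rewrite divr_ge0 ?enorm_ge0 ?ltW.
have u1 : enorm x / rho <= 1 by rewrite ler_pdivrMr// mul1r ltW.
rewrite ger0_norm ?mulr_ge0 ?flat_ge0 ?exprn_ge0//.
apply: (@le_trans _ _ (1 * (enorm x / rho) ^+ (2 * k.+1))).
  by rewrite ler_wpM2r ?exprn_ge0// flat0_le1.
rewrite mul1r; apply: ler_wiXn2l => //.
by rewrite mulnS addnC leq_add2r.
Qed.

End test_function.

(** * Integral of a power of the radius over a ball *)

Section radial_power.
Context (R : realType) (n : nat).
Local Notation N := n.+1.
Local Notation leb := (lebesgue_rV R N).
Local Notation mu := (@lebesgue_measure R).
Variables (rho m : R).
Hypotheses (rho0 : 0 < rho) (m0 : 0 < m).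

Let B : set 'rV[R]_N := eball N rho `\ 0.

Lemma measurable_pball : measurable B.
Proof. by apply: measurableD; [exact: measurable_eball|exact: measurable_rV_set1]. Qed.

Let P (y : 'rV[R]_N) : R := (enorm y / rho) `^ m * \1_B y.

Lemma measurable_radial : measurable_fun setT (fun y : 'rV[R]_N => (enorm y / rho) `^ m).
Proof.
apply: (@measurableT_comp _ _ _ _ _ _ (fun s : R => s `^ m)); first exact: measurable_powR.
by apply: measurable_funM => //; exact: measurable_enorm.
Qed.

Lemma integral_powR_itv (c : R) : 0 < c -> c < 1 ->
  (\int[mu]_(t in `[1%R, (c^-1)%R[) (t^-1 * (t * c) `^ m)%:E = (m^-1 * (1 - c `^ m))%:E)%E.
Proof.
move=> c0 c1; have ci : 1 < c^-1 by rewrite invf_gt1.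
pose F (t : R) : R := m^-1 * (t * c) `^ m.
have dF (t : R) : 0 < t -> is_derive t 1 F (t^-1 * (t * c) `^ m).
  move=> t0; have tc : 0 < t * c by rewrite mulr_gt0.
  have d1 : is_derive t 1 (fun t : R => c * t) (c * 1).
    by apply: is_derive_scale; exact: is_derive_id.
  have d2 : is_derive (c * t) 1 (fun s => s `^ m) (m * (c * t) `^ (m - 1)).
    by apply: is_derive1_powR; rewrite mulrC.
  have d3 := is_derive_scale m^-1 (is_derive_comp d2 d1).
  have -> : F = (fun t => m^-1 * ((fun s => s `^ m) \o (fun t => c * t)) t).
    by apply/funext => s; rewrite /F /= (mulrC s).
  apply: (is_derive_eq d3).
  rewrite -(@mulr_powRB1 _ (t * c))// ?ltW// (mulrC c t).
  by field; rewrite !gt_eqF.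
have cF (t : R) : 0 < t -> {for t, continuous (fun t : R => t^-1 * (t * c) `^ m)}.
  move=> t0.
  have c2 : {for t, continuous F} := is_derive_continuous (dF t t0).
  have c3 : {for t, continuous (fun t : R => t^-1)} by apply: inv_continuous; rewrite gt_eqF.
  have -> : (fun t : R => t^-1 * (t * c) `^ m) = (fun t => t^-1 * (m * F t)).
    by apply/funext => s; rewrite /F (mulrA m) mulfV ?mul1r// gt_eqF.
  exact: (cvgM c3 (cvgM (cvg_cst m) c2)).
have t0 t : t \in `[1, c^-1] -> 0 < t.
  by rewrite in_itv/= => /andP[t1 _]; exact: lt_le_trans t1.
rewrite integral_itv_bndo_bndc; last first.
  apply/measurable_EFinP; apply: measurable_funTS; apply: measurable_funM.
    exact: measurable_inv.
  apply: (@measurableT_comp _ _ _ _ _ _ (fun s : R => s `^ m)); first exact: measurable_powR.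
  exact: measurable_funM.
have -> : (m^-1 * (1 - c `^ m))%:E = ((F c^-1)%:E - (F 1)%:E)%E.
  by rewrite -EFinB /F mulVf ?gt_eqF// mul1r powR1 mulr1 mulrBr mulr1.
apply: continuous_FTC2 => //.
- by apply: continuous_in_subspaceT => t; rewrite inE/= => /t0; exact: cF.
- split; first by move=> t; rewrite in_itv/= => /andP[t1 _]; case: (dF t (lt_trans ltr01 t1)).
    apply: cvg_at_right_filter; exact: is_derive_continuous (dF 1 ltr01).
  apply: cvg_at_left_filter; apply: is_derive_continuous (dF _ _).
  by rewrite invr_gt0.
- move=> t; rewrite in_itv/= => /andP[t1 _]; rewrite derive1E.
  by have [_] := dF t (lt_trans ltr01 t1).
Qed.

Lemma ray_integral_radial (x : 'rV[R]_N) :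
  (\int[mu]_(t in `[1%R, +oo[) ((t^-1)%:E * (P (t *: x))%:E) =
   (m^-1 * (1 - (enorm x / rho) `^ m) * \1_B x)%:E)%E.
Proof.
rewrite [\1_B x]indicE; have [/set_mem xB|xB] := boolP (x \in B); last first.
  rewrite mulr0; apply: integral0_eq => t; rewrite /= in_itv/= andbT => t1.
  have t0 : 0 < t := lt_le_trans ltr01 t1.
  rewrite /P indicE memNset ?mulr0 ?mule0//= => -[]; rewrite /eball/= enormZ gtr0_norm//.
  move=> tx /eqP; rewrite scaler_eq0 negb_or => /andP[_ x0].
  move/negP: xB; apply; apply/mem_set; split; last exact/eqP.
  by apply: le_lt_trans tx; rewrite ler_peMl ?enorm_ge0.
rewrite mulr1; have [xr /eqP x0] := xB; have ex := enorm_gt0 x0.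
set c := enorm x / rho.
have c0 : 0 < c by rewrite divr_gt0.
have c1 : c < 1 by rewrite ltr_pdivrMr// mul1r.
rewrite -integral_powR_itv//.
rewrite [LHS]integral_mkcond [RHS]integral_mkcond; apply: eq_integral => t _.
rewrite !patchE mem_itvcy.
have -> : (t \in `[1, c^-1[%classic) = (1 <= t) && (t * c < 1).
  apply/idP/idP; rewrite inE/= in_itv/=.
    by move=> /andP[-> tc]; rewrite -ltr_pdivlMr// mul1r.
  by move=> /andP[-> tc]; rewrite -[c^-1]mul1r ltr_pdivlMr.
case: ifPn => //= t1; have t0 : 0 < t := lt_le_trans ltr01 t1.
rewrite /P enormZ gtr0_norm// -mulrA -/c indicE.
have -> : (t *: x \in B) = (t * c < 1).
  rewrite /c mulrA ltr_pdivrMr// mul1r.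
  apply/idP/idP; first by move=> /set_mem[]; rewrite /eball/= enormZ gtr0_norm.
  move=> tx; apply/mem_set; split; first by rewrite /eball/= enormZ gtr0_norm.
  by apply/eqP; rewrite scaler_eq0 negb_or gt_eqF.
case: (t * c < 1); [by rewrite mulr1 EFinM|by rewrite mulr0 mule0].
Qed.

(** Integrating over rays replaces polar coordinates: with [I] the integral and [V] the volume,
    [integral_rays] applied to the power itself reads [(V - I) / m = I / N], which is solved for
    [I]. *)
Lemma integral_radial_power :
  (\int[leb]_(x in B) ((enorm x / rho) `^ m)%:E = (N%:R / (N%:R + m))%:E * leb B)%E.
Proof.
have mB := measurable_pball; have mr := measurable_radial.
have P0 y : 0 <= P y by rewrite mulr_ge0// powR_ge0.
have mP : measurable_fun setT (fun y => (P y)%:E).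
  by apply/measurable_EFinP; apply: measurable_funM => //; exact: measurable_indic.
have := @integral_rays R n 1 (fun y => (P y)%:E) ltr01 mP (fun y => P0 y).
under eq_integral do rewrite ray_integral_radial.
have ind (f : 'rV[R]_N -> R) : (\int[leb]_x (f x * \1_B x)%:E = \int[leb]_(x in B) (f x)%:E)%E.
  rewrite [RHS]integral_mkcond; apply: eq_integral => x _.
  by rewrite patchE indicE; case: ifPn => _; rewrite ?mulr1// mulr0.
rewrite !ind expr1n mulr1; set I := (\int[leb]_(x in B) ((_ / _) `^ _)%:E)%E => E.
have I0 : (0 <= I)%E by apply: integral_ge0 => x _; rewrite lee_fin powR_ge0.
have P1 x : B x -> (enorm x / rho) `^ m <= 1.
  move=> [xr _]; have : (enorm x / rho) `^ m <= 1 `^ m.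
    apply: ge0_ler_powR; rewrite ?nnegrE ?(ltW m0)// ?divr_ge0 ?enorm_ge0 ?(ltW rho0)//.
    by rewrite ler_pdivrMr// mul1r ltW.
  by rewrite powR1.
(* Stated as a sum, to avoid a subtraction of extended reals before both integrals are known to be
   finite. *)
have V : (\int[leb]_(x in B) (m^-1 * (1 - (enorm x / rho) `^ m))%:E + (m^-1)%:E * I =
    (m^-1)%:E * leb B)%E.
  rewrite -ge0_integralZl_EFin//; first last.
  - by rewrite invr_ge0 ltW.
  - by apply/measurable_EFinP; exact: measurable_funTS.
  - by move=> x _; rewrite lee_fin powR_ge0.
  rewrite -ge0_integralD//; first last.
  - by apply/measurable_EFinP/measurable_funTS/measurable_funM.
  - by move=> x _; rewrite -EFinM lee_fin mulr_ge0 ?invr_ge0 ?powR_ge0 ?(ltW m0).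
  - apply/measurable_EFinP/measurable_funTS/measurable_funM => //.
    exact: measurable_funB.
  - move=> x Bx; rewrite lee_fin mulr_ge0 ?invr_ge0 ?(ltW m0)// subr_ge0.
    exact: P1.
  rewrite -integral_cst//; apply: eq_integral => x _.
  by rewrite -EFinM -EFinD; congr EFin; ring.
have Vf : leb B \is a fin_num.
  rewrite ge0_fin_numE//; apply: le_lt_trans (@eball_lty R N rho).
  by apply: le_measure; rewrite ?inE//; [exact: measurable_eball|move=> x []].
have If : I \is a fin_num.
  rewrite ge0_fin_numE//; apply: (@le_lt_trans _ _ (leb B)).
    rewrite -[leRHS]mul1e -integral_cst//; apply: ge0_le_integral => //.
    - by move=> x _; rewrite lee_fin powR_ge0.
    - by apply/measurable_EFinP; exact: measurable_funTS.
  by move: Vf; rewrite ge0_fin_numE.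
move: V; rewrite E -(fineK If) -(fineK Vf) -!EFinM -EFinD => -[].
have n0 : 0 < N%:R :> R by rewrite ltr0n.
move: (fine I) (fine (leb B)) (N%:R) n0 => i b a a0 h; congr EFin.
have -> : b = m * (a^-1 * i + m^-1 * i) by rewrite h mulrA mulfV ?mul1r// gt_eqF.
by field; rewrite !gt_eqF// addr_gt0.
Qed.

End radial_power.

Section test_quotient.
Context (R : realType) (n : nat).
Local Notation N := n.+1.
Local Notation leb := (lebesgue_rV R N).
Implicit Types (x : 'rV[R]_N) (p r rho : R) (k : nat).

Lemma flat0_gt0 (s : R) : 0 < s -> 0 < flat 0 s.
Proof. by move=> s0; rewrite /flat s0 expr0 invr1 mul1r expR_gt0. Qed.

Lemma pball_gt0 rho : 0 < rho -> (0 < leb (eball N rho `\ (0%R : 'rV[R]_N)))%E.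
Proof.
move=> rho0; have mB := @measurable_pball R n rho.
apply: (lt_le_trans (@eball_gt0 R N rho rho0)).
apply: (@le_trans _ _ (leb ((eball N rho `\ (0%R : 'rV[R]_N)) `|` [set 0%R]))).
  apply: le_measure; rewrite ?inE; [exact: measurable_eball| |].
    by apply: measurableU => //; exact: measurable_rV_set1.
  by move=> x xr; have [->|/eqP x0] := eqVneq x 0; [right|left].
have := measureU2 leb mB (measurable_rV_set1 (0 : 'rV[R]_N)).
by rewrite [X in (_ <= _ + X)%E -> _]lebesgue_rV_set0// adde0.
Qed.

Lemma pball_lty rho : (leb (eball N rho `\ (0%R : 'rV[R]_N)) < +oo)%E.
Proof.
apply: le_lt_trans (@eball_lty R N rho); apply: le_measure; rewrite ?inE.
- exact: measurable_pball.
- exact: measurable_eball.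
- by move=> x [].
Qed.

Definition test_slope_cst r rho k : R := ((2 * k.+1)%:R + (2 + 4 * r ^+ 2)) / rho.

(** The energy is bounded through the radial power integral, and the test function is constant on
    the sphere, equal to its flat factor; in the quotient the volume of the ball and a factor [N]
    cancel. *)
Definition test_bound p r rho k : R :=
  (test_slope_cst r rho k `^ p + 1) * (rho / (N%:R + (2 * k + 1)%:R * p)) /
  flat 0 (rho ^+ 2 - r ^+ 2) `^ p.

Lemma test_density_le p r rho k x : 1 < p -> 0 < r -> r < rho ->
  eball N rho x -> x != 0 ->
  enorm (grad (test_fun r rho k) x) `^ p + `|test_fun r rho k x| `^ p <=
  (test_slope_cst r rho k `^ p + 1) * (enorm x / rho) `^ ((2 * k + 1)%:R * p).
Proof.
move=> p1 r0 rrho xr x0; have rho0 : 0 < rho := lt_trans r0 rrho.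
have p0 : 0 < p := lt_trans ltr01 p1.
have u0 : 0 <= enorm x / rho by rewrite divr_ge0 ?enorm_ge0 ?ltW.
have A0 : 0 <= test_slope_cst r rho k.
  by rewrite divr_ge0 ?(ltW rho0)// addr_ge0// addr_ge0// mulr_ge0// sqr_ge0.
rewrite powRrM powR_mulrn// mulrDl mul1r -powRM ?exprn_ge0//.
apply: lerD; apply: (ge0_ler_powR (ltW p0)); rewrite ?nnegrE ?enorm_ge0 ?normr_ge0 ?exprn_ge0//.
- by rewrite mulr_ge0// exprn_ge0.
- exact: enorm_grad_test_fun.
- exact: test_fun_bound.
Qed.

Lemma steklov_test p r rho k : 1 < p -> 0 < r -> r < rho ->
  (steklov N p r rho <= (test_bound p r rho k)%:E)%E.
Proof.
move=> p1 r0 rrho; have rho0 : 0 < rho := lt_trans r0 rrho.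
have p0 : 0 < p := lt_trans ltr01 p1.
pose w := @test_fun R n r rho k; have sw : smooth w by exact: smooth_test_fun.
pose B : set 'rV[R]_N := eball N rho `\ 0.
have mB : measurable B := @measurable_pball R n rho.
pose m := (2 * k + 1)%:R * p; have m0 : 0 < m by rewrite mulr_gt0// ltr0n addn1.
pose A := test_slope_cst r rho k `^ p + 1.
have A0 : 0 < A by rewrite ltr_wpDl ?powR_ge0.
pose V := fine (leb B).
have Vf : leb B \is a fin_num by rewrite ge0_fin_numE//; exact: pball_lty.
have V0 : 0 < V by rewrite fine_gt0// pball_gt0//=; exact: pball_lty.
pose f0 := flat 0 (rho ^+ 2 - r ^+ 2).
have f00 : 0 < f0.
  by apply: flat0_gt0; rewrite subr_gt0 ltr_pXn2r// ?nnegrE ltW.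
have md : measurable_fun setT (fun x => enorm (grad w x) `^ p + `|w x| `^ p).
  by apply: measurable_energy_density; [exact: measurable_smooth|exact: measurable_grad].
have mr := @measurable_radial R n rho m.
have E1 : (energy p (eball N rho) w (grad w) <= (A * (N%:R / (N%:R + m) * V))%:E)%E.
  (* The origin is a null set; it is removed because the gradient bound is stated for nonzero
     points. *)
  rewrite /energy (@ge0_negligible_integral _ _ _ leb (eball N rho) [set 0])//; first last.
  - exact: lebesgue_rV_set0.
  - by move=> x _; rewrite lee_fin addr_ge0// powR_ge0.
  - by apply/measurable_EFinP; exact: measurable_funTS.
  - exact: measurable_eball.
  - exact: measurable_rV_set1.
  rewrite EFinM (EFinM (_ / _)) fineK// -integral_radial_power//.
  rewrite -ge0_integralZl_EFin//; last 3 first.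
  - by move=> x _; rewrite lee_fin powR_ge0.
  - by apply/measurable_EFinP; exact: measurable_funTS.
  - exact: ltW.
  apply: ge0_le_integral => //.
  - by move=> x _; rewrite lee_fin addr_ge0// powR_ge0.
  - by apply/measurable_EFinP; exact: measurable_funTS.
  - by apply: emeasurable_funM => //; apply/measurable_EFinP; exact: measurable_funTS.
  - move=> x [xr /eqP x0]; rewrite -EFinM lee_fin.
    exact: test_density_le.
have b1 : boundary_energy p rho w = (N%:R / rho * (f0 `^ p * V))%:E.
  rewrite /boundary_energy surface_integral//; last first.
    by apply/measurable_EFinP; apply: measurable_normpow; exact: measurable_smooth.
  have -> : (N%:R / rho * (f0 `^ p * V))%:E =
      ((N%:R / rho)%:E * ((f0 `^ p)%:E * leb B))%E.
    by rewrite -(fineK Vf) -/V -!EFinM.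
  rewrite -(integral_cst _ mB); congr (_ * _)%E.
  apply: eq_integral => x; rewrite inE => -[_ /eqP x0].
  have ex := enorm_gt0 x0.
  have nr : enorm ((rho / enorm x) *: x) = rho.
    by rewrite enormZ ger0_norm ?divr_ge0 ?(ltW rho0) ?(ltW ex)// divfK ?gt_eqF.
  by rewrite /w test_funE nr divff ?gt_eqF// !expr1n mulr1 ger0_norm// flat_ge0.
have b0 : 0 < N%:R / rho * (f0 `^ p * V).
  by rewrite !mulr_gt0 ?invr_gt0// powR_gt0.
have vw : smooth_vanishing_on (eball N r) w by split => // x; exact: test_fun_vanish.
apply: (le_trans (steklov_le p1 rho0 vw _ _)).
- exact: le_lt_trans E1 (ltry _).
- by rewrite b1 lte_fin.
rewrite b1 inver gt_eqF//.
apply: (@le_trans _ _ ((A * (N%:R / (N%:R + m) * V))%:E * ((N%:R / rho * (f0 `^ p * V))^-1)%:E)%E).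
  by apply: lee_wpmul2r => //; rewrite lee_fin invr_ge0 ltW.
rewrite -EFinM lee_fin le_eqVlt; apply/orP; left; apply/eqP.
rewrite /test_bound -/A -/m -/f0.
have fp : f0 `^ p != 0 by rewrite gt_eqF// powR_gt0.
have : N%:R + m != 0 by rewrite gt_eqF// addr_gt0.
have : N%:R != 0 :> R by rewrite pnatr_eq0.
move: (N%:R) (f0 `^ p) fp => a b b0' a0 am0; field.
by rewrite am0 a0 b0' !gt_eqF.
Qed.

End test_quotient.

(** * Asymptotics *)

Section limits.
Context (R : realType).
Implicit Types (a : R).

Lemma cvg_div_pinfty a : a / x @[x --> +oo] --> (0 : R).
Proof.
rewrite -(mulr0 a); apply: cvgM; first exact: cvg_cst.
apply/gtr0_cvgV0; last exact: cvg_id.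
by near=> x; near: x; apply: nbhs_pinfty_gt; exact: num_real.
Unshelve. all: by end_near. Qed.

Lemma cvg_powR_pinfty a : 0 < a -> x `^ a @[x --> +oo] --> +oo.
Proof.
move=> a0; apply/cvgryPge => A; near=> x.
pose B := Num.max A 1.
have B1 : 1 <= B by rewrite le_max lexx orbT.
have B0 : 0 <= B by exact: le_trans B1.
apply: (@le_trans _ _ B); first by rewrite le_max lexx.
rewrite -[leLHS](powRr1 B0) -(mulVf (lt0r_neq0 a0)) powRrM.
have xB : B `^ a^-1 <= x by near: x; apply: nbhs_pinfty_ge; exact: num_real.
by apply: ge0_ler_powR; rewrite ?nnegrE ?powR_ge0 ?(ltW a0)// (le_trans _ xB)// powR_ge0.
Unshelve. all: by end_near. Qed.

Lemma continuous_powR a (s : R) : 0 < s -> {for s, continuous (fun x => x `^ a)}.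
Proof. by move=> s0; apply: is_derive_continuous (is_derive1_powR a s0). Qed.

Lemma cvg_powR (T : Type) (F : set_system T) (FF : Filter F) (f : T -> R) (l a : R) :
  0 < l -> f x @[x --> F] --> l -> f x `^ a @[x --> F] --> l `^ a.
Proof.
by move=> l0 fl; exact: (cvg_comp f (fun x => x `^ a) fl (@continuous_powR a l l0)).
Qed.

End limits.

Section steklov_asymptotics.
Context (R : realType) (n : nat) (p r : R).
Local Notation N := n.+2.
Hypotheses (r0 : 0 < r) (p1 : 1 < p).
Let S (rho : R) : R := fine (steklov N p r rho).
Let K := trace_cst p.
Let p0 : 0 < p. Proof. exact: lt_trans p1. Qed.
Let p10 : 0 < p - 1. Proof. by rewrite subr_gt0. Qed.
Let K0 : 0 < K. Proof. exact: trace_cst_gt0. Qed.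

(** The two bounds also exclude [-oo] and [+oo], which [fine] would turn into 0. *)
Lemma steklov_fin rho k : r < rho ->
  (K + N%:R / rho)^-1 <= S rho <= test_bound n.+1 p r rho k /\
  steklov N p r rho \is a fin_num.
Proof.
move=> rrho; have rho0 : 0 < rho := lt_trans r0 rrho.
have L0 : 0 < K + N%:R / rho by rewrite addr_gt0// divr_gt0.
have lo := @steklov_ge R n.+1 p r rho _ p1 rho0 L0
  (fun phi h => trace_smooth p1 rho0 h.1).
have hi := @steklov_test R n.+1 p r rho k p1 r0 rrho.
have fi : steklov N p r rho \is a fin_num.
  rewrite fin_numE; apply/andP; split.
    by rewrite gt_eqF// (lt_le_trans _ lo)// ltNyr.
  by rewrite lt_eqF// (le_lt_trans hi)// ltry.
by split=> //; rewrite -!lee_fin /S fineK// lo.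
Qed.

(** Bounds [(rho / r)^(m + N)] for [rho < 2 r]: the exponent [(m + N) (rho - r) / r] is at most
    [2 (p - 1) + N + 1], where [m] exceeds [rho (p - 1) / (rho - r)] by at most 1. *)
Definition hole_cst : R := expR (2 * (p - 1) + N%:R + 1).

Lemma steklov_near_hole rho : r < rho -> rho < 2 * r ->
  (hole_cst * (rho - r) `^ (p - 1))^-1 <= S rho.
Proof.
move=> rrho rho2; have rho0 : 0 < rho := lt_trans r0 rrho.
have d0 : 0 < rho - r by rewrite subr_gt0.
(* With this weight [k^(-1/(p-1)) = 1 / (rho - r)], so the required exponent [m] is of order
   [1 / (rho - r)]. *)
pose k := (rho - r) `^ (p - 1); have k0 : 0 < k by rewrite powR_gt0.
pose y := rho * ((p - 1) * k `^ (- (p - 1)^-1)).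
have yE : y = rho * (p - 1) / (rho - r).
  rewrite /y /k -powRrM mulrN mulfV ?gt_eqF// powR_inv1 ?ltW//; ring.
pose m := (Num.truncn y).+1.
have ym : y <= m%:R by rewrite ltW//; exact: Num.Theory.truncnS_gt.
have y0 : 0 <= y by rewrite !mulr_ge0 ?powR_ge0// ltW.
have my : m%:R <= y + 1.
  rewrite /m -natr1 lerD2r; by have /andP[] := Num.Theory.truncn_itv y0.
have [_ fi] := steklov_fin 0 rrho.
pose L := hole_cst * k; have L0 : 0 < L by rewrite mulr_gt0// expR_gt0.
rewrite -lee_fin /S fineK//.
apply: steklov_ge => // phi [sp v0].
apply: (le_trans (trace_hole p1 r0 rrho k0 ym sp v0)).
apply: lee_wpmul2r; first exact: energy_ge0.
rewrite lee_fin mulrC ler_wpM2r ?(ltW k0)//.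
have -> : rho / r = 1 + (rho - r) / r by field; rewrite gt_eqF.
(* The inequality [1 + u <= exp u] turns the growing power into an exponential with bounded
   exponent. *)
apply: (@le_trans _ _ (expR ((rho - r) / r) ^+ (m + N))).
  by apply: lerXn2r; rewrite ?nnegrE ?expR_ge0 ?expR_ge1Dx// addr_ge0// divr_ge0// ltW.
rewrite -expRM_natl ler_expR mulrA ler_pdivrMr// natrD.
apply: (@le_trans _ _ ((y + 1 + N%:R) * (rho - r))).
  by apply: ler_wpM2r; [exact: ltW|rewrite lerD2r].
rewrite mulrDl mulrDl yE divfK ?gt_eqF//.
have : N%:R * (rho - r) <= N%:R * r by rewrite ler_wpM2l//; lra.
have : rho * (p - 1) <= 2 * r * (p - 1).
  by apply: ler_wpM2r; exact: ltW.
move: (N%:R : R) => a; nra.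
Qed.

Lemma steklov_cvgy : S rho @[rho --> r^'+] --> +oo.
Proof.
have C0 : 0 < hole_cst by exact: expR_gt0.
apply/cvgryPge => A; near=> rho.
have rrho : r < rho by near: rho; exact: nbhs_right_gt.
have rho2 : rho < 2 * r by near: rho; apply: nbhs_right_lt; rewrite ltr_pMl// ltr1n.
apply: le_trans (steklov_near_hole rrho rho2).
have d0 : 0 < rho - r by rewrite subr_gt0.
pose B := Num.max A 1; have B0 : 0 < B by rewrite lt_max ltr01 orbT.
apply: (@le_trans _ _ B); first by rewrite le_max lexx.
rewrite -[leLHS]invrK lef_pV2 ?posrE ?invr_gt0 ?mulr_gt0 ?powR_gt0//.
rewrite -ler_pdivlMl//.
have -> : hole_cst^-1 * B^-1 = ((hole_cst^-1 * B^-1) `^ (p - 1)^-1) `^ (p - 1).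
  by rewrite -powRrM mulVf ?gt_eqF// powRr1// mulr_ge0 ?invr_ge0 ?ltW.
apply: ge0_ler_powR; rewrite ?nnegrE ?powR_ge0 ?(ltW p10) ?(ltW d0)//.
rewrite lerBlDl ltW//; near: rho; apply: nbhs_right_lt.
by rewrite ltrDl powR_gt0// mulr_gt0 ?invr_gt0// lt_max ltr01 orbT.
Unshelve. all: by end_near. Qed.

Let c : R := (p - 1) `^ - p^-1.
Let c0 : 0 < c. Proof. by rewrite powR_gt0. Qed.
(* The exponent [2 k] of the test function, chosen so that [2 k / rho] tends to
   the minimizer [c] of [(c ^ p + 1) / (c p)]. *)
Let degree (rho : R) : nat := Num.truncn (c * rho / 2).

(** Truncation changes [c rho / 2] by less than 1, hence the quotient by less than [2 / rho]. *)
Lemma degree_cvg : (2 * degree rho)%:R / rho @[rho --> +oo] --> c.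
Proof.
apply: (@squeeze_cvgr _ _ _ _ (fun rho : R => c - 2 / rho) (fun=> c)); last 2 first.
- rewrite -[X in _ --> X]subr0; apply: cvgB; first exact: cvg_cst.
  exact: cvg_div_pinfty.
- exact: cvg_cst.
near=> rho; have rho0 : 0 < rho by near: rho; apply: nbhs_pinfty_gt; exact: num_real.
have /Num.Theory.truncn_itv : 0 <= c * rho / 2 by rewrite !mulr_ge0// ltW.
rewrite -/(degree rho) natrM -[(degree rho).+1%:R]natr1 => /andP[lo hi].
rewrite ler_pdivlMr// mulrBl divfK ?gt_eqF// ler_pdivrMr//.
by apply/andP; split; lra.
Unshelve. all: by end_near. Qed.

Lemma flat_cvg1 : flat 0 (rho ^+ 2 - r ^+ 2) `^ p @[rho --> +oo] --> (1 : R).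
Proof.
have sq_cvg : rho ^+ 2 - r ^+ 2 @[rho --> +oo] --> +oo.
  apply/cvgryPge => A; near=> rho; rewrite lerBrDr.
  by near: rho; move: (A + _); apply/cvgryPge; exact: cvg_exprn_pinfty.
have inv_cvg : (rho ^+ 2 - r ^+ 2)^-1 @[rho --> +oo] --> (0 : R).
  apply/gtr0_cvgV0 => //; near=> rho.
  by near: rho; move/cvgryPgt: sq_cvg; exact.
have exp_cvg : expR (- (rho ^+ 2 - r ^+ 2)^-1) @[rho --> +oo] --> (1 : R).
  rewrite -(expR0 R) -oppr0.
  apply: (@cvg_comp _ _ _ (fun rho => - (rho ^+ 2 - r ^+ 2)^-1) expR _ (nbhs (- 0))).
    exact: cvgN.
  exact: continuous_expR.
apply: (@cvg_trans _ (expR (- (rho ^+ 2 - r ^+ 2)^-1) `^ p @[rho --> +oo])).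
  apply: near_eq_cvg; near=> rho.
  have q0 : 0 < rho ^+ 2 - r ^+ 2 by near: rho; move/cvgryPgt: sq_cvg; exact.
  by rewrite /flat q0 expr0 invr1 mul1r.
have <- : 1 `^ p = 1 :> R by rewrite powR1.
exact: cvg_powR.
Unshelve. all: by end_near. Qed.

Lemma slope_cst_cvg :
  test_slope_cst r rho (degree rho) `^ p @[rho --> +oo] --> c `^ p.
Proof.
apply: cvg_powR => //.
rewrite (_ : (fun rho => _) = (fun rho : R => (2 * degree rho)%:R / rho +
    (2 + (2 + 4 * r ^+ 2)) / rho)).
  rewrite -[X in _ --> X]addr0; apply: cvgD; first exact: degree_cvg.
  exact: cvg_div_pinfty.
apply/funext => rho; rewrite /test_slope_cst mulnS natrD -mulrDl; congr (_ / _).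
ring.
Qed.

(** Here the upper and lower bounds meet: [c^p = 1/(p-1)] and [K = (p-1) c], so both sides equal
    [1 / ((p-1) c)]. *)
Lemma trace_cst_optimal : K^-1 = (c `^ p + 1) * (c * p)^-1.
Proof.
have cp : c `^ p = (p - 1)^-1.
  by rewrite /c -powRrM mulNr mulVf ?gt_eqF// powR_inv1// ltW.
have Kc : K^-1 = ((p - 1) * c)^-1.
  rewrite /K /trace_cst /c; congr (_^-1).
  rewrite -[X in _ = X * _](powRr1 (ltW p10)) -powRD; last by rewrite (gt_eqF p10) implybT.
  by congr (_ `^ _); field; rewrite gt_eqF.
rewrite cp Kc; field.
by rewrite !gt_eqF.
Qed.

Lemma test_bound_cvg : test_bound n.+1 p r rho (degree rho) @[rho --> +oo] --> K^-1.
Proof.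
have h : rho / (N%:R + (2 * degree rho + 1)%:R * p) @[rho --> +oo] --> (c * p)^-1.
  apply: (@cvg_trans _ ((((2 * degree rho)%:R / rho) * p + (N%:R + p) / rho)^-1
      @[rho --> +oo])).
    apply: near_eq_cvg; near=> rho.
    have rho0 : 0 < rho by near: rho; apply: nbhs_pinfty_gt; exact: num_real.
    rewrite -[RHS]invf_div; congr (_^-1); rewrite natrD; field; exact: lt0r_neq0.
  apply: cvgV; first by rewrite mulf_neq0// gt_eqF.
  rewrite -[X in _ --> X]addr0; apply: cvgD; last exact: cvg_div_pinfty.
  by apply: cvgM; [exact: degree_cvg|exact: cvg_cst].
have -> : K^-1 = (c `^ p + 1) * (c * p)^-1 * 1^-1 by rewrite invr1 mulr1 trace_cst_optimal.
apply: cvgM; last by apply: cvgV; [exact: oner_neq0|exact: flat_cvg1].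
by apply: cvgM => //; apply: cvgD; [exact: slope_cst_cvg|exact: cvg_cst].
Unshelve. all: by end_near. Qed.

Lemma steklov_cvg_pinfty : S rho @[rho --> +oo] --> K^-1.
Proof.
apply: (@squeeze_cvgr _ _ _ _ (fun rho : R => (K + N%:R / rho)^-1)
    (fun rho => test_bound n.+1 p r rho (degree rho))); last 2 first.
- apply: cvgV; first by rewrite gt_eqF.
  rewrite -[X in _ --> X]addr0; apply: cvgD; first exact: cvg_cst.
  exact: cvg_div_pinfty.
- exact: test_bound_cvg.
near=> rho; have rrho : r < rho by near: rho; apply: nbhs_pinfty_gt; exact: num_real.
by have [] := steklov_fin (degree rho) rrho.
Unshelve. all: by end_near. Qed.

Let q := p / (p - 1).

(** Expanding the product gives [S^-q - (N-1)/rho S^-(q-1) + 1]; both powers tend to 0 as [S] tends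
    to infinity, since [q - 1 = 1/(p-1) > 0]. *)
Lemma Qfun_cvg_hole : Qfun N p r rho @[rho --> r^'+] --> (1 : R).
Proof.
have q1 : 0 < q - 1.
  by rewrite /q -[X in _ - X](mulfV (lt0r_neq0 p10)) -mulrBl opprB addrC subrK divr_gt0.
have h a : 0 < a -> (S rho `^ a)^-1 @[rho --> r^'+] --> (0 : R).
  move=> a0; apply: (@cvg_comp _ _ _ S (fun s => (s `^ a)^-1) _ +oo%R _ steklov_cvgy).
  apply/gtr0_cvgV0; last exact: cvg_powR_pinfty.
  by near=> s; rewrite powR_gt0//; near: s; apply: nbhs_pinfty_gt; exact: num_real.
have q0 : 0 < q by rewrite (lt_trans q1)// gtrBl.
have : (S rho `^ q)^-1 - (N%:R - 1) / rho * (S rho `^ (q - 1))^-1 + 1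
    @[rho --> r^'+] --> 0 - (N%:R - 1) / r * 0 + 1.
  apply: cvgD; last exact: cvg_cst.
  apply: cvgB; first exact: h.
  apply: cvgM; last exact: h.
  apply: cvgM; first exact: cvg_cst.
  by apply: cvg_at_right_filter; apply: inv_continuous; exact: lt0r_neq0.
rewrite mulr0 subr0 add0r; apply: cvg_trans; apply: near_eq_cvg; near=> rho.
have rrho : r < rho by near: rho; exact: nbhs_right_gt.
have S0 : 0 < S rho.
  have [/andP[lo _] _] := steklov_fin 0 rrho; apply: lt_le_trans lo.
  by rewrite invr_gt0 addr_gt0// divr_gt0// (lt_trans r0).
rewrite /Qfun -/(S rho) -/q; congr (_ + 1).
rewrite -(mulr_powRB1 (ltW S0) q0); field.
by rewrite !gt_eqF ?powR_gt0// (lt_trans r0).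
Unshelve. all: by end_near. Qed.

(** Once [rho < 2 r <= S], the inequality [N - 1 >= 1] gives [(N-1) S / rho > 1], so the bracket in
    [Qfun] is negative. *)
Lemma Qfun_lt1_hole : \forall rho \near r^'+, Qfun N p r rho < 1.
Proof.
near=> rho.
have rrho : r < rho by near: rho; exact: nbhs_right_gt.
have rho2 : rho < 2 * r by near: rho; apply: nbhs_right_lt; rewrite ltr_pMl// ltr1n.
have rho0 : 0 < rho := lt_trans r0 rrho.
have S2 : 2 * r <= S rho by near: rho; move/cvgryPge: steklov_cvgy; exact.
have S0 : 0 < S rho by apply: lt_le_trans S2; rewrite mulr_gt0.
rewrite /Qfun -/(S rho) -[X in _ < X]add0r ltrD2r pmulr_rlt0; last first.
  by rewrite invr_gt0 powR_gt0.
rewrite subr_lt0 mulrAC ltr_pdivlMr// mul1r.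
apply: (lt_le_trans rho2); apply: (le_trans S2).
by rewrite ler_peMl ?(ltW S0)// -natr1 addrK ler1n.
Unshelve. all: by end_near. Qed.

(** The term with [1/rho] disappears and [(1/K)^-q = K^q = p - 1], because the exponent [(p-1)/p] in
    [K] is the inverse of [q]. *)
Lemma Qfun_cvg_pinfty : Qfun N p r rho @[rho --> +oo] --> p.
Proof.
have E : p = ((K^-1) `^ q)^-1 * (1 - 0 * K^-1) + 1.
  rewrite mul0r subr0 mulr1 -(powR_inv1 (ltW K0)) -powRrM /K /trace_cst -powRrM.
  rewrite -powRN (_ : - (_ * _) = 1); first by rewrite powRr1 ?(ltW p10)// subrK.
  by rewrite /q; field; rewrite !gt_eqF.
rewrite {2}E; apply: cvgD; last exact: cvg_cst.
apply: cvgM.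
  apply: cvgV; first by rewrite gt_eqF// powR_gt0// invr_gt0.
  by apply: cvg_powR steklov_cvg_pinfty; rewrite invr_gt0.
apply: cvgB; first exact: cvg_cst.
apply: cvgM; last exact: steklov_cvg_pinfty.
exact: cvg_div_pinfty.
Qed.

End steklov_asymptotics.

Theorem proposition1p5 (R : realType) (N : nat) (r p : R) :
  (2 <= N)%N -> 0 < r -> 1 < p ->
  [/\ Qfun N p r rho @[rho --> r^'+] --> (1 : R),
      (\forall rho \near r^'+, Qfun N p r rho < 1) &
      Qfun N p r rho @[rho --> +oo] --> p].
Proof.
case: N => [|[|n]]// _ r0 p1; split.
- exact: Qfun_cvg_hole.
- exact: Qfun_lt1_hole.
- exact: Qfun_cvg_pinfty.
Qed.
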